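(* Let $\{X_n\}_{n=1}^\infty$ be nonnegative, bounded, i.i.d. random variables with $\mathbb E(\ln X_1)=0$ and $\mathbb E\big((\ln X_1^2)^2\big)=\sigma^2\in(0,\infty)$, and let $f(z)=\sum_{n=0}^\infty a_nz^n$ be an analytic function. (i) If $\limsup_{n\to\infty}|a_n|^{\frac{\sqrt2}{\sigma\sqrt{n\ln\ln n}}}<\frac1e$, then $f\in H_*$. (ii) If $\liminf_{n\to\infty}|a_n|^{\frac{\sqrt2}{\sigma\sqrt{n\ln\ln n}}}>\frac1e$ or $\limsup_{n\to\infty}|a_n|^{\frac{\sqrt2}{\sigma\sqrt{n\ln\ln n}}}>1$, then $f\notin H_*$. (iii) $$\sup_{f\in H_*}\limsup_{n\to\infty}|a_n|^{\frac{\sqrt2}{\sigma\sqrt{n\ln\ln n}}}\in[e^{-1},1],$$ and each $a\in[e^{-1},1]$ may be achieved, i.e. for each such $a$ there is $f=\sum a_nz^n\in H_*$ with $\limsup_{n\to\infty}|a_n|^{\frac{\sqrt2}{\sigma\sqrt{n\ln\ln n}}}=a$. (iv) If $f\in H_*$, then $$\liminf_{n\to\infty}|a_n|^{\frac{\sqrt2}{\sigma\sqrt{n\ln\ln n}}}\in[0,e^{-1}],$$ and each $a\in[0,e^{-1}]$ may be achieved, i.e. for each such $a$ there is $f=\sum a_nz^n\in H_*$ whose liminf equals $a$.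
   Context: For the i.i.d. sequence $\{X_n\}$ on a probability space $(\Omega,\mathcal F,\mathbb P)$ put $w_0=1$, $w_n=X_1\cdots X_n$ ($n\ge1$). For each $\omega\in\Omega$, the random Hardy space is $$H^2_\mu(\omega)=\Big\{f(z)=\sum_{n=0}^\infty a_nz^n:\ \|f\|^2(\omega)=\sum_{n=0}^\infty|a_n|^2w_n(\omega)^2<\infty\Big\},$$ where $\mu$ is the law of $X_1$. The deterministic space $H_*$ is the set of $f(z)=\sum_{n=0}^\infty a_nz^n$ such that $f\in H^2_\mu$ almost surely. The expressions with $\ln\ln n$ are considered for $n\ge3$. *)

(* Defs.v *)
From HB Require Import structures.
From mathcomp Require Export all_boot all_order all_algebra finmap.
From mathcomp Require Export all_classical all_reals all_analysis.
From mathcomp Require Export complex.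

Set Implicit Arguments.
Unset Strict Implicit.
Unset Printing Implicit Defensive.

Export Order.TTheory GRing.Theory Num.Theory.
Export numFieldNormedType.Exports.
Export Normc.

Local Open Scope classical_set_scope.
Local Open Scope complex_scope.
Local Open Scope ring_scope.

Section iid.
Local Open Scope ereal_scope.
Context {d : measure_display} {T : measurableType d} {R : realType}.
Variables (P : probability T R) (X : nat -> {RV P >-> R}).

Definition mutually_independent : Prop :=
  forall (J : {fset nat}) (B : nat -> set R),
    (forall i, i \in J -> measurable (B i)) ->
    P (\bigcap_(i in [set` J]) X i @^-1` B i) =
    \prod_(i <- J) P (X i @^-1` B i).

Definition identically_distributed : Prop :=
  forall (n : nat) (B : set R), measurable B ->
    distribution P (X n) B = distribution P (X 0%N) B.

End iid.

(* A power series f(z) = a_0 + a_1 z + a_2 z^2 + ... is represented by its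
   sequence of coefficients a : nat -> R[i].  It is the expansion of an
   analytic function when it converges on some disc centered at 0. The ^o
   gives R[i] its usual topology. *)
Definition analytic_series {R : realType} (a : nat -> R[i]) : Prop :=
  exists2 r : R, 0 < r & forall z : R[i], normc z < r ->
    cvgn (series (fun n => a n * z ^+ n) : nat -> R[i]^o).

Section random_hardy_space.
Context {d : measure_display} {T : measurableType d} {R : realType}.
Variables (P : probability T R) (X : nat -> {RV P >-> R}).

(* Sequences are indexed from 0: X k stands for X_(k+1), so that
   weight n = X_1 ... X_n. *)
Definition weight (n : nat) (w : T) : R := \prod_(k < n) X k w.

Definition hardy_norm2 (w : T) (a : nat -> R[i]) : \bar R :=
  (\sum_(0 <= n <oo) (normc (a n) ^+ 2 * weight n w ^+ 2)%:E)%E.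

Definition random_hardy (w : T) : set (nat -> R[i]) :=
  [set a | (hardy_norm2 w a < +oo)%E].

Definition Hstar : set (nat -> R[i]) :=
  [set a | {ae P, forall w, random_hardy w a}].

End random_hardy_space.

(* The terms with n < 3, where ln (ln n) is not meaningful, do not affect the
   limits superior and inferior. *)
Definition lnln_root {R : realType} (sigma : R) (a : nat -> R[i]) (n : nat) :
    \bar R :=
  (normc (a n) `^
     (Num.sqrt 2 / (sigma * Num.sqrt (n%:R * ln (ln n%:R)))))%:E.

(* Main.v *)
From HB Require Import structures.
Require Import Defs.
From mathcomp Require Import measurable_realfun ring lra zify.

(** Write [Y k = ln X_(k+1)] and [S n = Y 0 + ... + Y (n - 1)], so that the
    weight [w_n] is [expR (S n)] almost surely.  The [Y k] are independent,
    identically distributed and centered, with variance [v = sigma ^ 2 / 4],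
    and bounded above.  With [lil x = sqrt (2 v x ln (ln x))], the
    quantity [|a_n| ^ (sqrt 2 / (sigma sqrt (n ln (ln n))))] is
    [|a_n| ^ (1 / lil n)]; writing [|a_n| = expR (- s_n * lil n)], the [n]-th
    term of the norm is [expR (2 (S n - s_n * lil n))].  Everything therefore
    reduces to the size of [S n] compared with [lil n], that is to the law of
    the iterated logarithm [limsup S n / lil n = 1], which is proved here.

    The steps are unbounded below, but as they are bounded above, their moment
    generating function at [t >= 0] is finite and equals
    [expR (t ^ 2 v / 2 (1 + o(1)))] when [t] decreases to [0]
    ([mgf_near0]).  All the probabilistic estimates are drawn from this.

    Upper half ([upper_lil]).  Freezing [expR (t * S n)] when it first passes a
    level yields a maximal inequality ([maximal_inequality]); for blocks of times
    growing geometrically with ratio [1 + e], the [k]-th block exceeds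
    [(1 + e) * lil] with probability of order [k ^ (- (1 + e / 2))], which is
    summable.

    Lower half ([lower_lil]).  Under the measure tilted by [expR (t * V)], an
    increment [V] of the walk sits near the slope prescribed by [t], because
    the moments at nearby exponents control the mass on both sides
    ([tilted_window]).  This gives [P (V > (1 - e) * lil n) >= c / k] for the
    block ending at the [k]-th term [n] of a geometric sequence.  Blocks are
    independent and the walk before a block is of smaller order with
    probability close to 1 ([walk_lil_small]), so such increments occur infinitely often.

    Membership.  If [s_n >= s > 1] eventually, the terms are summable by the
    upper half; if [s_n <= s < 1] eventually, infinitely many terms are at least 1 by
    the lower half; and if [s_n <= - s < 0] infinitely often, the same happens
    because [S n > - s * lil n] with probability tending to 1.
    Limits superior in [[1/e, 1]] are reached by coefficients supported on very
    sparse times, along which [S n / lil n] tends to 0 ([sparse_Hstar]); limits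
    inferior below [1/e] by [c ^ (lil n)] ([subcritical_Hstar]), and [1/e] itself by
    letting [s_n] decrease slowly to 1 ([critical_Hstar]). *)

Set Implicit Arguments.
Unset Strict Implicit.
Unset Printing Implicit Defensive.
Local Open Scope classical_set_scope.
Local Open Scope complex_scope.
Local Open Scope ring_scope.

(** * Level sets *)

Lemma measurable_superlevel d (T : measurableType d) (R : realType) (f : T -> R) c :
  measurable_fun setT f -> measurable [set w | c <= f w].
Proof.
move=> mf; rewrite (_ : [set _ | _] = setT `&` (f @^-1` `[c, +oo[)); first exact: mf.
by apply/seteqP; split => w /=; rewrite in_itv/= andbT// => -[].
Qed.

Lemma measurable_strict_superlevel d (T : measurableType d) (R : realType)
    (f : T -> R) c :
  measurable_fun setT f -> measurable [set w | c < f w].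
Proof.
move=> mf; rewrite (_ : [set _ | _] = setT `&` (f @^-1` `]c, +oo[)); first exact: mf.
by apply/seteqP; split => w /=; rewrite in_itv/= andbT// => -[].
Qed.

Lemma measurable_strict_sublevel d (T : measurableType d) (R : realType)
    (f : T -> R) c :
  measurable_fun setT f -> measurable [set w | f w < c].
Proof.
move=> mf; rewrite (_ : [set _ | _] = setT `&` (f @^-1` `]-oo, c[)); first exact: mf.
by apply/seteqP; split => w /=; rewrite in_itv/= ?andbT// => -[].
Qed.

(** * Independence of disjoint groups of variables *)

(** Independence makes the law of the pair the product of the laws, so that
    the identity is Tonelli's theorem. *)
Lemma integralM_indep_events d d1 d2 (T : measurableType d) (T1 : measurableType d1)
    (T2 : measurableType d2) (R : realType) (P : probability T R)
    (U : {RV P >-> T1}) (V : {RV P >-> T2}) (f : T1 -> R) (g : T2 -> R) :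
  (forall A B, measurable A -> measurable B ->
    P (U @^-1` A `&` V @^-1` B) = P (U @^-1` A) * P (V @^-1` B))%E ->
  measurable_fun setT f -> measurable_fun setT g ->
  (forall x, 0 <= f x) -> (forall x, 0 <= g x) ->
  (\int[P]_w (f (U w) * g (V w))%:E =
  \int[P]_w (f (U w))%:E * \int[P]_w (g (V w))%:E)%E.
Proof.
move=> UV mf mg f0 g0.
have mW : measurable_fun setT (fun w => (U w, V w)).
  by apply: measurable_fun_pair; exact: measurable_funPT.
pose W : {RV P >-> (T1 * T2)%type} := HB.pack (fun w => (U w, V w))
   (isMeasurableFun.Build _ _ _ _ (fun w => (U w, V w)) mW).
pose h (z : T1 * T2) : \bar R := (f z.1 * g z.2)%:E.
have mh : measurable_fun setT h.
  by apply/measurable_EFinP; apply: measurable_funM; exact: measurableT_comp.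
have h0 z : (0 <= h z)%E by rewrite lee_fin mulr_ge0.
have mfE : measurable_fun setT (EFin \o f) by exact/measurable_EFinP.
have mgE : measurable_fun setT (EFin \o g) by exact/measurable_EFinP.
have fE0 x : (0 <= (EFin \o f) x)%E by rewrite lee_fin.
have gE0 x : (0 <= (EFin \o g) x)%E by rewrite lee_fin.
transitivity (\int[distribution P U \x distribution P V]_z h z)%E.
  transitivity (\int[distribution P W]_z h z)%E.
    by rewrite ge0_integral_distribution.
  apply: eq_measure_integral => A mA _; apply/esym; apply: product_measure_unique.
    by move=> A' B' mA' mB'; rewrite /distribution/= /pushforward/= -UV.
  exact: mA.
rewrite fubini_tonelli1//.
transitivity (\int[distribution P U]_x ((f x)%:E * \int[P]_w (g (V w))%:E))%E.
  apply: eq_integral => x _; rewrite /fubini_F/=.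
  under eq_integral do rewrite /h/= EFinM.
  rewrite (ge0_integralZl _ _ mgE)//= ?lee_fin//; last by move=> y _; exact: gE0.
  by rewrite (ge0_integral_distribution _ mgE).
have V0 : (0 <= \int[P]_w (g (V w))%:E)%E.
  by apply: integral_ge0 => w _; rewrite lee_fin.
apply: (etrans (ge0_integralZr (distribution P U) measurableT mfE _ V0)).
  by move=> x _; exact: fE0.
by rewrite (ge0_integral_distribution _ mfE).
Qed.

Section independence.
Local Open Scope ereal_scope.
Context {d : measure_display} {T : measurableType d} {R : realType}.
Variables (P : probability T R) (X : nat -> {RV P >-> R}).

Definition cylinders (J : set nat) : set_system T :=
  [set A | exists (K : {fset nat}) (B : nat -> set R),
    [/\ [set` K] `<=` J, forall i, measurable (B i) &
        A = \bigcap_(i in [set` K]) X i @^-1` B i]].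

Definition depends_on (J : set nat) (U : T -> R) :=
  @measurable_fun _ _ (g_sigma_algebraType (cylinders J)) R setT U.

(** An index missing from one of the two sets of constraints is constrained by the
    whole line there. *)
Lemma cylinders_setI J : setI_closed (cylinders J).
Proof.
move=> A A' [K [B [KJ mB ->]]] [K' [B' [KJ' mB' ->]]].
pose C (L : {fset nat}) (D : nat -> set R) i := if i \in L then D i else setT.
exists (K `|` K')%fset, (fun i => C K B i `&` C K' B' i); split.
- by move=> i /=; rewrite inE => /orP[/KJ|/KJ'].
- by move=> i; apply: measurableI; rewrite /C; case: ifP.
- apply/seteqP; split => w /=.
    move=> [Kw K'w] i /= _; rewrite /C; split; case: ifP => // iK;
      [exact: Kw|exact: K'w].
  move=> KK'w; split => i /= iK.
    by have := KK'w i; rewrite /= inE iK => /(_ isT)[]; rewrite /C iK.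
  by have := KK'w i; rewrite /= inE iK orbT => /(_ isT)[_]; rewrite /C iK.
Qed.

Lemma cylinders_measurable J : cylinders J `<=` measurable.
Proof.
move=> _ [K [B [_ mB ->]]]; apply: bigcap_measurableType => i _.
by rewrite -[X in measurable X]setTI; exact: measurable_funPT.
Qed.

Lemma sigma_cylinders_measurable J : <<s cylinders J >> `<=` measurable.
Proof.
apply: smallest_sub; last exact: cylinders_measurable.
exact: sigma_algebra_measurable.
Qed.

Lemma depends_on_measurable J U : depends_on J U -> measurable_fun setT U.
Proof.
move=> mU _ B mB; apply: (@sigma_cylinders_measurable J).
exact: mU.
Qed.

Lemma depends_on_X (J : set nat) i : J i -> depends_on J (X i).
Proof.
move=> Ji _ B mB; rewrite setTI; apply: sub_sigma_algebra.
exists [fset i]%fset, (fun=> B); split => //.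
- by move=> j /=; rewrite inE => /eqP ->.
- apply/seteqP; split => w /=; first by move=> Bw j /=; rewrite inE => /eqP ->.
  by move=> /(_ i); apply; rewrite /= inE.
Qed.

Lemma sigma_cylindersS (J L : set nat) : J `<=` L ->
  <<s cylinders J >> `<=` <<s cylinders L >>.
Proof.
move=> JL; apply: sub_sigma_algebra2 => _ [M [C [MJ mC ->]]].
by exists M, C; split => //; exact: subset_trans JL.
Qed.

Lemma depends_onS (J K : set nat) U : J `<=` K -> depends_on J U -> depends_on K U.
Proof.
by move=> JK mU _ B mB; apply: sigma_cylindersS JK _ (mU measurableT B mB).
Qed.

Hypothesis indep : mutually_independent X.

(** The product rule holds for cylinders by hypothesis.  Cylinders are stable under
    intersection, so for one fixed event both sides are measures that agree on
    the generated sigma-algebra; this is used for each of the two events in turn. *)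
Lemma sigma_indep (J K : set nat) (A B : set T) : J `&` K = set0 ->
  <<s cylinders J >> A -> <<s cylinders K >> B -> P (A `&` B) = P A * P B.
Proof.
move=> JK0.
have extend (G : set_system T) (C : set T) : setI_closed G -> G `<=` measurable ->
    measurable C -> (forall D, G D -> P (D `&` C) = P D * P C) ->
    forall D, <<s G >> D -> P (D `&` C) = P D * P C.
  move=> GI Gm mC GC D GD.
  have fC : P C \is a fin_num by exact: fin_num_measure.
  have c0 : (0 <= fine (P C))%R by exact: fine_ge0.
  pose m1 := mrestr P mC; pose m2 := mscale (NngNum c0) P.
  have GE : [set D | G D /\ D `<=` setT] = G.
    by apply/seteqP; split => // E [].
  have m2E E : m2 E = P C * P E by rewrite -[in RHS](fineK fC).
  have := @g_sigma_algebra_measure_unique_trace _ R T G setT measurableT _ _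
    m1 m2.
  rewrite !GE => /(_ Gm GI) H; rewrite -[LHS]/(m1 D) muleC -m2E; apply: H => //.
  - by rewrite -[LHS]/(m1 setT) -[RHS]/(m2 setT) m2E /m1 /mrestr setTI probability_setT mule1.
  - by move=> A0 /GC E; rewrite -[RHS]/(m2 A0) m2E muleC -E.
  - by rewrite -[X in X < _]/(m1 setT) /m1 /mrestr setTI ltey_eq fC.
move=> JA KB.
apply: (extend (cylinders J)) => //; [exact: cylinders_setI|
  exact: cylinders_measurable|exact: (@sigma_cylinders_measurable K)|].
move=> D JD; rewrite setIC muleC.
apply: (extend (cylinders K)) => //; [exact: cylinders_setI|
  exact: cylinders_measurable|exact: (@cylinders_measurable J)|].
move=> E [K' [C' [K'K mC' ->]]].
have [J' [C [J'J mC ->]]] := JD.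
have dis i : i \in J' -> i \notin K'.
  move=> /J'J Ji; apply/negP => /K'K Ki.
  by have : (J `&` K) i by []; rewrite JK0.
pose D0 i := if i \in J' then C i else C' i.
rewrite -[X in P X = _](_ : \bigcap_(i in [set` (J' `|` K')%fset]) X i @^-1` D0 i = _).
  rewrite indep; last by move=> i _; rewrite /D0; case: ifP.
  rewrite !indep//.
  have /(perm_big _) -> : perm_eq (J' `|` K')%fset (J' ++ K').
    apply: uniq_perm; first exact: fset_uniq.
      rewrite cat_uniq !fset_uniq andbT/= -all_predC; apply/allP => i iK /=.
      by apply/negP => /dis; rewrite iK.
    by move=> i; rewrite mem_cat inE.
  rewrite big_cat/=.
  rewrite muleC; congr (_ * _); apply: eq_big_seq => i iJ; rewrite /D0.
    by case: ifP => // /dis; rewrite iJ.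
  by rewrite iJ.
apply/seteqP; split => w /=.
  move=> H; split => i /= iK; have := H i; rewrite /= inE iK ?orbT/D0 => /(_ isT).
    by case: ifP => // /dis; rewrite iK.
  by rewrite iK.
move=> [H' H] i /=; rewrite inE /D0 => /orP[iJ|iK].
  by rewrite iJ; exact: H.
by case: ifP => [/dis|_]; [rewrite iK|exact: H'].
Qed.

Lemma integralM_indep (J K : set nat) (U V : T -> R) : J `&` K = set0 ->
  depends_on J U -> depends_on K V -> (forall w, 0 <= U w)%R -> (forall w, 0 <= V w)%R ->
  \int[P]_w (U w * V w)%:E = \int[P]_w (U w)%:E * \int[P]_w (V w)%:E.
Proof.
move=> JK0 mU mV U0 V0.
have mU' := depends_on_measurable mU; have mV' := depends_on_measurable mV.
pose U' : {RV P >-> R} := HB.pack U (isMeasurableFun.Build _ _ _ _ U mU').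
pose V' : {RV P >-> R} := HB.pack V (isMeasurableFun.Build _ _ _ _ V mV').
have mn : measurable_fun setT (fun x : R => `|x|%R) by exact: measurableT_comp.
transitivity (\int[P]_w (`|U' w| * `|V' w|)%:E).
  by apply: eq_integral => w _; rewrite !ger0_norm.
rewrite (@integralM_indep_events _ _ _ _ _ _ _ _ U' V' (fun x => `|x|%R) (fun x => `|x|%R))//.
  by congr (_ * _); apply: eq_integral => w _; rewrite ger0_norm.
move=> A B mA mB; apply: (sigma_indep JK0).
- by rewrite -[X in <<s _ >> X]setTI; exact: mU.
- by rewrite -[X in <<s _ >> X]setTI; exact: mV.
Qed.

End independence.

(** * Second-order bounds on the exponential *)

Section exponential_inequalities.
Context {R : realType}.
Implicit Types u C : R.

Lemma is_derive_ge0_homo (f df : R -> R) :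
  (forall x : R, is_derive x 1 f (df x)) -> (forall x, 0 <= df x) ->
  {homo f : x y / x <= y}.
Proof.
move=> f' df0 x y xy; rewrite -subr_ge0.
have [|c _ ->] := @MVT_segment R f df x y xy (fun x _ => f' x).
  apply: derivable_within_continuous => z _.
  by have [] := f' z.
by rewrite mulr_ge0// subr_ge0.
Qed.

(* The derivative [expR u - 1 - u] is nonnegative on the whole line, so that one
   function settles [0 <= u] and [u <= 0] with opposite inequalities. *)
Let taylor2_homo : {homo (fun u : R => expR u - (1 + u + u ^+ 2 / 2)) : x y / x <= y}.
Proof.
apply: (@is_derive_ge0_homo _ (fun u => expR u - (1 + u))) => [x|x].
  by apply: is_derive_eq; rewrite /GRing.scale/=; field.
by rewrite subr_ge0 expR_ge1Dx.
Qed.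

(* Multiplied by [expR (- u)], the remainder estimates with [expR u] as factor
   become the monotonicity of this function, taken at [- u]. *)
Let taylor2_exp_homo :
  {homo (fun u : R => - ((1 - u) * expR u + u ^+ 2 / 2)) : x y / x <= y}.
Proof.
apply: (@is_derive_ge0_homo _ (fun u => u * (expR u - 1))) => [x|x].
  by apply: is_derive_eq; rewrite /GRing.scale/=; field.
have [x0|x0] := leP 0 x.
  by rewrite mulr_ge0// subr_ge0 -(expR0 R) ler_expR.
by rewrite mulr_le0 ?subr_le0 -?(expR0 R) ?ler_expR ?ltW.
Qed.

Lemma expR_le_taylor2 u C : 0 <= C -> u <= C ->
  expR u <= 1 + u + u ^+ 2 / 2 * expR C.
Proof.
move=> C0 uC; have [u0|u0] := leP 0 u; last first.
  have := taylor2_homo (ltW u0); rewrite expR0.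
  have : 1 <= expR C by rewrite -(expR0 R) ler_expR.
  have : 0 <= u ^+ 2 by exact: sqr_ge0.
  nra.
have /taylor2_exp_homo : - u <= 0 by rewrite oppr_le0.
rewrite expR0 => H.
have uC' : expR u <= expR C by rewrite ler_expR.
have u2 : 0 <= u ^+ 2 by exact: sqr_ge0.
suff : expR u <= 1 + u + u ^+ 2 / 2 * expR u by nra.
have E : expR (- u) * expR u = 1 by rewrite -expRD addNr expR0.
have e0 := expR_gt0 u.
have : 0 <= ((1 + u) * expR (- u) + u ^+ 2 / 2 - 1) * expR u.
  rewrite mulr_ge0 ?(ltW e0)//; move: H => /=; rewrite sqrrN opprK subr0 expr0n/=; lra.
by rewrite mulrBl mulrDl -!mulrA E; lra.
Qed.

Lemma expR_ge_taylor2 u :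
  1 + u + u ^+ 2 / 2 * Num.min 1 (expR u) <= expR u.
Proof.
have [u0|u0] := leP 0 u.
  have := taylor2_homo u0; rewrite expR0.
  have : 1 <= expR u by rewrite -(expR0 R) ler_expR.
  by move=> /min_idPl ->; lra.
have /taylor2_exp_homo : 0 <= - u by rewrite oppr_ge0 ltW.
rewrite expR0 => H.
have u1 : expR u <= 1 by rewrite -(expR0 R) ler_expR ltW.
rewrite (min_idPr u1).
have E : expR (- u) * expR u = 1 by rewrite -expRD addNr expR0.
have e0 := expR_gt0 u.
have : 0 <= (1 - ((1 + u) * expR (- u) + u ^+ 2 / 2)) * expR u.
  rewrite mulr_ge0 ?(ltW e0)//; move: H => /=; rewrite sqrrN opprK subr0 expr0n/=; lra.
by rewrite mulrBl mulrDl -!mulrA E; lra.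
Qed.

End exponential_inequalities.

(** * The moment generating function near 0 *)

Section moment_generating_function.
Context {d : measure_display} {T : measurableType d} {R : realType}.
Variables (P : probability T R) (Y : {RV P >-> R}) (K v : R).
Hypothesis K_ge0 : 0 <= K.
Hypothesis Y_le : forall w, Y w <= K.
Hypothesis Y_int : P.-integrable setT (EFin \o Y).
Hypothesis Y_mean : \int[P]_w Y w = 0.
Hypothesis Y2_int : P.-integrable setT (fun w => (Y w ^+ 2)%:E).
Hypothesis Y_var : \int[P]_w (Y w ^+ 2) = v.
Hypothesis v_gt0 : 0 < v.

Definition mgf (t : R) : R := \int[P]_w expR (t * Y w).

Lemma integrable_expRM t : 0 <= t ->
  P.-integrable setT (fun w => (expR (t * Y w))%:E).
Proof.
move=> t0.
apply: (@le_integrable _ _ _ P _ measurableT _ (fun=> (expR (t * K))%:E)).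
- apply/measurable_EFinP; apply: measurableT_comp => //.
  by apply: measurable_funM => //; exact: measurable_funPT.
- move=> w _ /=; rewrite lee_fin !ger0_norm ?expR_ge0// ler_expR.
  by rewrite ler_wpM2l.
- exact: finite_measure_integrable_cst.
Qed.

Lemma mgf_le t : 0 <= t -> mgf t <= 1 + t ^+ 2 / 2 * expR (t * K) * v.
Proof.
move=> t0; set c := t ^+ 2 / 2 * expR (t * K).
have c_int : P.-integrable setT (fun=> (1 : R)%:E) by exact: finite_measure_integrable_cst.
have tY_int : P.-integrable setT (fun w => (t * Y w)%:E).
  by under eq_fun do rewrite EFinM; exact: integrableZl.
have cY_int : P.-integrable setT (fun w => (c * Y w ^+ 2)%:E).
  by under eq_fun do rewrite EFinM; exact: integrableZl.
have D_int : P.-integrable setT (fun w => (1 + t * Y w)%:E).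
  by under eq_fun do rewrite EFinD; exact: (integrableD measurableT c_int tY_int).
apply: (@le_trans _ _ (\int[P]_w ((1 + t * Y w) + c * Y w ^+ 2))).
  apply: le_Rintegral => //; first exact: integrable_expRM.
    rewrite /comp; under eq_fun do rewrite EFinD.
    exact: integrableD.
  move=> w _; have := @expR_le_taylor2 R (t * Y w) (t * K).
  rewrite mulr_ge0// ler_wpM2l// => /(_ isT isT) /le_trans; apply.
  by rewrite lerD2l /c exprMn; lra.
rewrite !RintegralD// !RintegralZl// Y_mean Y_var mulr0 addr0.
by rewrite Rintegral_cst// [fine _]/= probability_setT mulr1.
Qed.

(* The truncation [Num.min 1 (expR (t * Y))] increases to 1 as [t] decreases to 0,
   which compensates for the steps being unbounded below. *)
Let truncated_second_moment e : 0 < e ->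
  exists2 t, 0 < t & v - e <= \int[P]_w (Y w ^+ 2 * Num.min 1 (expR (t * Y w))).
Proof.
move=> e0.
pose q (n : nat) w := (Y w ^+ 2 * Num.min 1 (expR (n.+1%:R^-1 * Y w)))%:E.
have q0 n w : (0 <= q n w)%E.
  by rewrite lee_fin mulr_ge0 ?sqr_ge0// le_min ler01 expR_ge0.
have qle n w : (q n w <= (Y w ^+ 2)%:E)%E.
  by rewrite lee_fin ler_piMr ?sqr_ge0// ge_min lexx.
have mq n : measurable_fun setT (q n).
  apply/measurable_EFinP; apply: measurable_funM.
    by apply: measurable_funX; exact: measurable_funPT.
  apply: measurable_minr => //; apply: measurableT_comp => //.
  by apply: measurable_funM => //; exact: measurable_funPT.
have ndq w : {homo q ^~ w : m n / (m <= n)%N >-> (m <= n)%E}.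
  move=> m n mn; rewrite lee_fin ler_wpM2l ?sqr_ge0//.
  have [Y0|Y0] := leP 0 (Y w).
    by rewrite !(min_idPl _) // -(expR0 R) ler_expR mulr_ge0.
  have H k : Num.min 1 (expR (k.+1%:R^-1 * Y w)) = expR (k.+1%:R^-1 * Y w).
    apply/min_idPr; rewrite -(expR0 R) ler_expR mulr_ge0_le0//.
    exact: ltW.
  rewrite !H ler_expR ler_wnM2r ?(ltW Y0)// lef_pV2 ?posrE ?ltr0n//.
  by rewrite ler_nat.
have qcvg w : q ^~ w @ \oo --> (Y w ^+ 2)%:E.
  apply/cvg_EFin; first by exists 0%N.
  rewrite /comp/= -[X in _ --> X]mulr1.
  apply: cvgM; first exact: cvg_cst.
  apply: (@squeeze_cvgr _ _ _ _ (fun n => 1 - n.+1%:R^-1 * `|Y w|) (fun=> 1)).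
  - near=> n; rewrite ge_min lexx/= andbT le_min gerBl mulr_ge0//=.
    apply: le_trans (expR_ge1Dx _); rewrite lerD2l -mulrN ler_wpM2l//.
    by rewrite lerNl -normrN ler_norm.
  - rewrite -[X in _ --> X]subr0; apply: cvgB; first exact: cvg_cst.
    rewrite -[X in _ --> X](mul0r `|Y w|); apply: cvgM; last exact: cvg_cst.
    exact: cvg_harmonic.
  - exact: cvg_cst.
have := @cvg_monotone_convergence _ _ _ P _ measurableT q mq
  (fun n w _ => q0 n w) (fun w _ => ndq w).
rewrite (_ : (\int[P]_w _)%E = v%:E); last first.
  rewrite -Y_var fineK; last exact: integrable_fin_num.
  by apply: eq_integral => w _; exact/cvg_lim.
have q_int n : P.-integrable setT (q n).
  apply: le_integrable Y2_int => // w _.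
  by rewrite !gee0_abs// lee_fin sqr_ge0.
move=> /fine_cvgP[_ /cvgrPdist_le /(_ e e0)[N _ /(_ N)]].
move=> /(_ (leqnn N)) /= /ler_normlP[_ H].
exists N.+1%:R^-1; first by rewrite invr_gt0.
by move: H; rewrite /Rintegral /=; lra.
Unshelve. all: end_near. Qed.

Lemma mgf_ge e : 0 < e -> exists2 t0, 0 < t0 &
  forall t, 0 <= t <= t0 -> 1 + t ^+ 2 / 2 * (v - e) <= mgf t.
Proof.
move=> /truncated_second_moment[t1 t10 Ht1]; exists t1 => // t /andP[t0 tt1].
have c_int : P.-integrable setT (fun=> (1 : R)%:E).
  exact: finite_measure_integrable_cst.
have tY_int : P.-integrable setT (fun w => (t * Y w)%:E).
  by under eq_fun do rewrite EFinM; exact: integrableZl.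
pose q w := Y w ^+ 2 * Num.min 1 (expR (t1 * Y w)).
have q_int : P.-integrable setT (fun w => (q w)%:E).
  apply: le_integrable Y2_int => //.
    apply/measurable_EFinP; apply: measurable_funM.
      by apply: measurable_funX; exact: measurable_funPT.
    apply: measurable_minr => //; apply: measurableT_comp => //.
    by apply: measurable_funM => //; exact: measurable_funPT.
  move=> w _ /=; rewrite lee_fin !ger0_norm ?sqr_ge0//.
    by rewrite ler_piMr ?sqr_ge0// ge_min lexx.
  by rewrite mulr_ge0 ?sqr_ge0// le_min ler01 expR_ge0.
have cq_int : P.-integrable setT (fun w => (t ^+ 2 / 2 * q w)%:E).
  by under eq_fun do rewrite EFinM; exact: (integrableZl measurableT _ q_int).
have D_int : P.-integrable setT (fun w => (1 + t * Y w)%:E).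
  by under eq_fun do rewrite EFinD; exact: (integrableD measurableT c_int tY_int).
apply: (@le_trans _ _ (\int[P]_w ((1 + t * Y w) + t ^+ 2 / 2 * q w))).
  rewrite !RintegralD// !RintegralZl// Y_mean mulr0 addr0.
  rewrite Rintegral_cst// [fine _]/= probability_setT mulr1 lerD2l.
  by rewrite ler_wpM2l// divr_ge0// sqr_ge0.
apply: le_Rintegral => //.
- rewrite /comp; under eq_fun do rewrite EFinD.
  exact: (integrableD measurableT D_int cq_int).
- exact: integrable_expRM.
move=> w _; apply: le_trans (expR_ge_taylor2 _); rewrite lerD2l.
rewrite exprMn [X in _ <= X * _]mulrAC -[leRHS]mulrA ler_wpM2l ?divr_ge0 ?sqr_ge0//.
rewrite /q ler_wpM2l ?sqr_ge0//.
have [Y0|Y0] := leP 0 (Y w).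
  by rewrite !(min_idPl _) // -(expR0 R) ler_expR mulr_ge0// ltW.
have H k : 0 <= k -> Num.min 1 (expR (k * Y w)) = expR (k * Y w).
  move=> k0; apply/min_idPr; rewrite -(expR0 R) ler_expR mulr_ge0_le0//.
  exact: ltW.
by rewrite !H ?(ltW t10)// ler_expR ler_wnM2r// ltW.
Qed.

(** Both Gaussian bounds hold because the two second-order Taylor bounds have
    the same leading term. *)
Lemma mgf_near0 e : 0 < e < 1 -> exists2 t0, 0 < t0 &
  forall t, 0 <= t <= t0 ->
    expR ((1 - e) * (t ^+ 2 / 2 * v)) <= mgf t <= expR ((1 + e) * (t ^+ 2 / 2 * v)).
Proof.
move=> /andP[e0 e1].
have ev : 0 < e / 2 * v by rewrite mulr_gt0// divr_gt0.
have [t1 t10 Ht1] := mgf_ge ev.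
(* the upper bound needs expR (t * K) <= 1 + e, the lower one t ^+ 2 * v <= e *)
pose t2 := ln (1 + e) / (K + 1); pose t3 := Num.min 1 (e / v).
have K1 : 0 < K + 1 by rewrite ltr_wpDl.
have e1ln : 0 < ln (1 + e) by rewrite ln_gt0 ?ltrDl.
have t20 : 0 < t2 by rewrite divr_gt0.
have t30 : 0 < t3 by rewrite lt_min ltr01 divr_gt0.
exists (Num.min t1 (Num.min t2 t3)); first by rewrite lt_min t10 lt_min t20 t30.
move=> t; rewrite !le_min => /andP[t0 /and4P[tt1 tt2 t_1 tev]].
have x0 : 0 <= t ^+ 2 / 2 * v by rewrite mulr_ge0 ?divr_ge0 ?sqr_ge0// ltW.
apply/andP; split.
  have := Ht1 t; rewrite t0 tt1 => /(_ isT); apply: le_trans.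
  have t2v : t ^+ 2 * v <= e.
    rewrite -ler_pdivlMr//; apply: le_trans tev.
    by rewrite expr2 ler_piMr.
  set x := t ^+ 2 / 2 * v in x0 *.
  have xe : x <= e / 2 by rewrite /x; lra.
  have -> : t ^+ 2 / 2 * (v - e / 2 * v) = (1 - e / 2) * x by rewrite /x; ring.
  have y1 : 0 < 1 - (1 - e) * x by nra.
  rewrite -(ler_pM2r y1); apply: (@le_trans _ _ 1); last first.
    have : 0 <= x * (e / 2 - x) by rewrite mulr_ge0// subr_ge0.
    have : 0 <= e * (x * x) by apply: mulr_ge0; [exact: ltW|exact: mulr_ge0].
    have : 0 <= (1 - e) * (x * x) by apply: mulr_ge0; [rewrite subr_ge0; exact: ltW|exact: mulr_ge0].
    nra.
  rewrite -[leRHS](expRxMexpNx_1 ((1 - e) * x)) ler_pM2l ?expR_gt0//.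
  exact: expR_ge1Dx.
apply: (le_trans (mgf_le t0)).
apply: le_trans (expR_ge1Dx _); rewrite lerD2l mulrAC [leRHS]mulrC ler_wpM2l//.
rewrite -[leRHS]lnK ?posrE; last lra.
rewrite ler_expR; move: tt2; rewrite ler_pdivlMr; last lra.
by apply: le_trans; rewrite ler_wpM2l// lerDl.
Qed.

End moment_generating_function.

(** * The random walk and its maximal inequality *)

Section random_walk.
Context {d : measure_display} {T : measurableType d} {R : realType}.
Variables (P : probability T R) (Y : nat -> {RV P >-> R}) (K v : R).

Record centered_iid : Prop := CenteredIid {
  iid_indep : mutually_independent Y;
  iid_ident : identically_distributed Y;
  iid_bound_ge0 : 0 <= K;
  iid_le : forall n w, Y n w <= K;
  iid_integrable : P.-integrable setT (EFin \o Y 0%N);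
  iid_mean : \int[P]_w Y 0%N w = 0;
  iid_integrable2 : P.-integrable setT (fun w => (Y 0%N w ^+ 2)%:E);
  iid_var : \int[P]_w (Y 0%N w ^+ 2) = v;
  iid_var_gt0 : 0 < v
}.

Hypothesis HY : centered_iid.
Local Notation psi := (mgf (Y 0%N)).

Definition walk (m l : nat) (w : T) : R := \sum_(k < l) Y (m + k)%N w.

Lemma walkS m l w : walk m l.+1 w = walk m l w + Y (m + l)%N w.
Proof. by rewrite /walk big_ord_recr. Qed.

Lemma walk0 m w : walk m 0 w = 0.
Proof. by rewrite /walk big_ord0. Qed.

Lemma walkD m l w : walk 0 (m + l) w = walk 0 m w + walk m l w.
Proof. by elim: l => [|l IH]; rewrite ?addn0 ?walk0 ?addr0// addnS !walkS IH addrA. Qed.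

Lemma depends_on_walk m l : depends_on Y [set k | (m <= k < m + l)%N] (walk m l).
Proof.
apply: (@measurable_sum _ (g_sigma_algebraType _)) => k.
by apply: depends_on_X => /=; rewrite leq_addr ltn_add2l ltn_ord.
Qed.

Lemma measurable_walk m l : measurable_fun setT (walk m l).
Proof. exact: depends_on_measurable (@depends_on_walk m l). Qed.

Lemma integral_ident (f : R -> \bar R) n : measurable_fun setT f ->
  (forall x, (0 <= f x)%E) ->
  (\int[P]_w f (Y n w) = \int[P]_w f (Y 0%N w))%E.
Proof.
move=> mf f0.
rewrite -[LHS]/(\int[P]_w (f \o Y n) w)%E -[RHS]/(\int[P]_w (f \o Y 0%N) w)%E.
rewrite -!(@ge0_integral_distribution _ _ _ _ _ P)//.
by apply: eq_measure_integral => A mA _; apply: (iid_ident HY).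
Qed.

Lemma integral_expR_step n t : 0 <= t ->
  (\int[P]_w (expR (t * Y n w))%:E = (psi t)%:E)%E.
Proof.
move=> t0.
rewrite (@integral_ident (fun x => (expR (t * x))%:E)).
- rewrite fineK//; apply: integrable_fin_num => //.
  by apply: (@integrable_expRM _ _ _ P (Y 0%N) K) => // w; exact: (iid_le HY).
- apply/measurable_EFinP; apply: measurableT_comp => //.
- by move=> x; rewrite lee_fin expR_ge0.
Qed.

(** Jensen's inequality for the exponential; hence freezing the process below can
    only lower its integral. *)
Lemma psi_ge1 t : 0 <= t -> 1 <= psi t.
Proof.
move=> t0; rewrite -lee_fin -(integral_expR_step 0%N t0).
have <- : (\int[P]_w (1 + t * Y 0%N w)%:E = 1)%E.
  have tY_int : P.-integrable setT (fun w => (t * Y 0%N w)%:E).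
    by under eq_fun do rewrite EFinM; exact: integrableZl (iid_integrable HY).
  under eq_integral do rewrite EFinD.
  rewrite integralD//; last exact: finite_measure_integrable_cst.
  rewrite integral_cst//= probability_setT mule1.
  under eq_integral do rewrite EFinM.
  rewrite integralZl//; last exact: (iid_integrable HY).
  have -> : (\int[P]_w (Y 0%N w)%:E = 0)%E.
    rewrite -[LHS]fineK; first by rewrite [fine _](iid_mean HY).
    exact: integrable_fin_num (iid_integrable HY).
  by rewrite mule0 adde0.
apply: le_integral => //.
- under eq_fun do rewrite EFinD; apply: integrableD => //.
    exact: finite_measure_integrable_cst.
  by under eq_fun do rewrite EFinM; exact: integrableZl (iid_integrable HY).
- by apply: (@integrable_expRM _ _ _ P (Y 0%N) K) => // w; exact: (iid_le HY).
- by move=> w _; rewrite lee_fin expR_ge1Dx.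
Qed.

Lemma integral_expR_walk m l t : 0 <= t ->
  (\int[P]_w (expR (t * walk m l w))%:E = (psi t ^+ l)%:E)%E.
Proof.
move=> t0; elim: l => [|l IH].
  under eq_integral do rewrite walk0 mulr0 expR0.
  by rewrite expr0 integral_cst//= probability_setT mule1.
under eq_integral do rewrite walkS mulrDr expRD.
rewrite (integralM_indep (iid_indep HY) (J := [set k | (m <= k < m + l)%N])
  (K := [set (m + l)%N])).
- by rewrite IH integral_expR_step// -EFinM exprSr.
- apply/seteqP; split => // k [/= /andP[_ +] E].
  by rewrite E ltnn.
- apply: measurableT_comp => //; apply: measurable_funM => //.
  exact: depends_on_walk.
- apply: measurableT_comp => //; apply: measurable_funM => //.
  exact: depends_on_X.
- by move=> w; exact: expR_ge0.
- by move=> w; exact: expR_ge0.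
Qed.

Lemma markov_ge0 (f : T -> R) c : measurable_fun setT f -> (forall w, 0 <= f w) ->
  0 < c -> (c%:E * P [set w | (c <= f w)%R] <= \int[P]_w (f w)%:E)%E.
Proof.
move=> mf f0 c0.
have mfE : measurable_fun setT (EFin \o f) by exact/measurable_EFinP.
have := @le_integral_abse _ _ _ P setT measurableT (EFin \o f) c mfE c0.
rewrite setTI.
have -> : [set x | (c%:E <= `|(EFin \o f) x|)%E] = [set w | c <= f w].
  by apply/seteqP; split => w /=; rewrite lee_fin ger0_norm.
congr (_ <= _)%E; apply: eq_integral => w _ /=.
by rewrite ger0_norm.
Qed.

(** The process [expR (t * walk 0 n)] frozen at its first passage above [c]. *)
Fixpoint stopped (t c : R) (n : nat) (w : T) : R :=
  if n is n'.+1 then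
    (if c <= stopped t c n' w then stopped t c n' w
     else stopped t c n' w * expR (t * Y n' w))
  else 1.

Lemma stopped_gt0 t c n w : 0 < stopped t c n w.
Proof.
by elim: n => //= n IH; case: ifP => // _; rewrite mulr_gt0 ?expR_gt0.
Qed.

Lemma stopped_walk t c n w : ~~ (c <= stopped t c n w) ->
  stopped t c n w = expR (t * walk 0 n w).
Proof.
elim: n => [|n IH] /=; first by rewrite walk0 mulr0 expR0.
case: ifP => [->//|/negbT Hn _].
by rewrite IH// walkS mulrDr expRD.
Qed.

Lemma stopped_passed t x n k w : 0 <= t -> (k <= n)%N -> x <= walk 0 k w ->
  expR (t * x) <= stopped t (expR (t * x)) n w.
Proof.
move=> t0 kn xk; have {}H : expR (t * x) <= stopped t (expR (t * x)) k w.
  apply: contraT => H; move: (H); rewrite (stopped_walk H) ler_expR.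
  by rewrite ler_wpM2l.
elim: n kn => [|n IH]; first by rewrite leqn0 => /eqP <-.
rewrite leq_eqVlt => /orP[/eqP <-//|]; rewrite ltnS => /IH /= Hn.
by rewrite Hn.
Qed.

Lemma depends_on_stopped t c n : depends_on Y [set k | (k < n)%N] (stopped t c n).
Proof.
elim: n => [|n IH]; first exact: measurable_cst.
have IH' : depends_on Y [set k | (k < n.+1)%N] (stopped t c n).
  by apply: depends_onS IH => k /= /ltnW.
apply: measurable_fun_ifT => //.
  apply: (@measurable_fun_ler _ (g_sigma_algebraType _)); last exact: IH'.
  exact: measurable_cst.
apply: measurable_funM; first exact: IH'.
apply: measurableT_comp => //.
apply: measurable_funM; first exact: measurable_cst.
by apply: depends_on_X => /=.
Qed.

(** On the part where the process is already frozen one step multiplies the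
    integral by 1, elsewhere by [psi t]. *)
Lemma integral_stopped t c n : 0 <= t ->
  (\int[P]_w (stopped t c n w)%:E <= (psi t ^+ n)%:E)%E.
Proof.
move=> t0; elim: n => [|n IH].
  by under eq_integral do [] => //=; rewrite integral_cst//= probability_setT mule1.
pose W := stopped t c n.
pose A w : R := if c <= W w then W w else 0.
pose B w : R := if c <= W w then 0 else W w.
have W0 w : 0 <= W w by rewrite ltW ?stopped_gt0.
have A0 w : 0 <= A w by rewrite /A; case: ifP.
have B0 w : 0 <= B w by rewrite /B; case: ifP.
have mc : @measurable_fun _ _ (g_sigma_algebraType (cylinders Y [set k | (k < n)%N]))
    _ setT (fun w => c <= W w).
  apply: (@measurable_fun_ler _ (g_sigma_algebraType _)); first exact: measurable_cst.
  exact: depends_on_stopped.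
have mA : depends_on Y [set k | (k < n)%N] A.
  apply: measurable_fun_ifT => //.
  exact: depends_on_stopped.
have mB : depends_on Y [set k | (k < n)%N] B.
  apply: measurable_fun_ifT => //.
  exact: depends_on_stopped.
have mA' := depends_on_measurable mA; have mB' := depends_on_measurable mB.
have mY : measurable_fun setT (fun w => expR (t * Y n w)).
  apply: measurableT_comp => //; apply: measurable_funM => //.
have -> : (\int[P]_w (stopped t c n.+1 w)%:E =
    \int[P]_w (A w)%:E + \int[P]_w (B w)%:E * (psi t)%:E)%E.
  rewrite -(integral_expR_step n t0).
  rewrite -(integralM_indep (iid_indep HY) (J := [set k | (k < n)%N])
    (K := [set n]))//.
  - rewrite -ge0_integralD//.
    + apply: eq_integral => w _; rewrite -EFinD /= -/W /A /B.
      by case: ifP => _; rewrite ?mul0r ?addr0 ?add0r.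
    + by move=> w _; rewrite lee_fin.
    + exact/measurable_EFinP.
    + by move=> w _; rewrite lee_fin mulr_ge0 ?expR_ge0.
    + by apply/measurable_EFinP; exact: measurable_funM.
  - by apply/seteqP; split => // k [/= + E]; rewrite E ltnn.
  - apply: measurableT_comp => //; apply: measurable_funM => //.
    exact: depends_on_X.
have p1 := psi_ge1 t0.
apply: (@le_trans _ _ ((\int[P]_w (A w)%:E + \int[P]_w (B w)%:E) * (psi t)%:E)%E).
  have : (0 <= \int[P]_w (A w)%:E)%E by apply: integral_ge0 => w _; rewrite lee_fin.
  have : (0 <= \int[P]_w (B w)%:E)%E by apply: integral_ge0 => w _; rewrite lee_fin.
  move: (\int[P]_w (A w)%:E)%E (\int[P]_w (B w)%:E)%E => iA iB iB0 iA0.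
  rewrite ge0_muleDl// leeD2r// -[leLHS]mule1 lee_wpmul2l ?lee_fin//.
rewrite -ge0_integralD//; last 4 first.
- by move=> w _; rewrite lee_fin.
- exact/measurable_EFinP.
- by move=> w _; rewrite lee_fin.
- exact/measurable_EFinP.
rewrite exprSr EFinM lee_wpmul2r ?lee_fin ?(le_trans _ p1)//.
apply: le_trans IH; rewrite le_eqVlt; apply/orP; left; apply/eqP.
apply: eq_integral => w _; rewrite -EFinD /A /B /W.
by case: ifP => _; rewrite ?addr0 ?add0r.
Qed.

Lemma measurable_exceed x n :
  measurable [set w | exists2 k, (k <= n)%N & x <= walk 0 k w].
Proof.
rewrite (_ : [set _ | _] =
  \bigcup_(k in [set k | (k <= n)%N]) [set w | x <= walk 0 k w]); last first.
  by apply/seteqP; split => w /= [k kn H]; exists k.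
by apply: bigcup_measurable => k _; exact/measurable_superlevel/measurable_walk.
Qed.

Lemma maximal_inequality t x n : 0 <= t ->
  (P [set w | exists2 k, (k <= n)%N & (x <= walk 0 k w)%R] <=
    (expR (- (t * x)) * psi t ^+ n)%:E)%E.
Proof.
move=> t0; have ms := depends_on_measurable (@depends_on_stopped t (expR (t * x)) n).
apply: (@le_trans _ _ (P [set w | expR (t * x) <= stopped t (expR (t * x)) n w])).
  apply: le_measure; rewrite ?inE.
  - exact: measurable_exceed.
  - exact: measurable_superlevel.
  - by move=> w /= [k kn xk]; exact: stopped_passed kn xk.
have := markov_ge0 ms (fun w => ltW (stopped_gt0 _ _ _ _)) (expR_gt0 (t * x)).
move=> /le_trans/(_ (integral_stopped (expR (t * x)) n t0)).
rewrite -lee_pdivlMl ?expR_gt0// => /le_trans; apply.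
by rewrite -EFinM expRN.
Qed.

End random_walk.

(** * The normalization of the law of the iterated logarithm *)

Section lil_normalization.
Context {R : realType}.
Variable v : R.
Hypothesis v_gt0 : 0 < v.

(** The square root vanishes where [ln (ln x)] is negative, so [lil] is nonnegative
    everywhere. *)
Definition lil (x : R) : R := Num.sqrt (2 * v * (x * ln (ln x))).

Lemma lil_ge0 x : 0 <= lil x. Proof. exact: sqrtr_ge0. Qed.

Lemma lil_sqr x : 0 <= x -> 0 <= ln (ln x) -> lil x ^+ 2 = 2 * v * (x * ln (ln x)).
Proof. by move=> x0 l0; rewrite sqr_sqrtr// !mulr_ge0// ltW. Qed.

Lemma ln_expR1 (x : R) : expR 1 <= x -> 1 <= ln x.
Proof.
move=> x1; rewrite -[leLHS]expRK ler_ln ?posrE ?expR_gt0//.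
by apply: lt_le_trans x1; exact: expR_gt0.
Qed.

Lemma lil_homo x y : expR 1 <= x -> x <= y -> lil x <= lil y.
Proof.
move=> ex xy; have x0 : 0 < x by apply: lt_le_trans ex; exact: expR_gt0.
have lx := ln_expR1 ex.
have lxy : ln x <= ln y by rewrite ler_ln ?posrE// (lt_le_trans x0).
apply: ler_wsqrtr; rewrite ler_pM2l ?mulr_gt0//.
apply: ler_pM => //; [exact: ltW|exact: ln_ge0|].
by rewrite ler_ln ?posrE//; apply: lt_le_trans _ => //; lra.
Qed.

Lemma ln_near_ge (A : R) : \forall x \near +oo, A <= ln x.
Proof.
exists (expR A); split => // x /ltW Ax.
by rewrite -[leLHS]expRK ler_ln ?posrE ?expR_gt0// (lt_le_trans _ Ax) ?expR_gt0.
Qed.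

Lemma ln_cvgy : @ln R x @[x --> +oo] --> +oo.
Proof. by apply/cvgryPge => A; exact: ln_near_ge. Qed.

Lemma lnln_near_ge (A : R) : \forall x \near +oo, A <= ln (ln x).
Proof. exact: (ln_cvgy (ln_near_ge A)). Qed.

Lemma lnln_near_le (c : R) : 0 < c -> \forall x \near +oo, ln (ln x) <= c * x.
Proof.
move=> c0; near=> x.
have x1 : 1 <= x by near: x; exact: nbhs_pinfty_ge.
have y1 : 1 <= ln x by near: x; exact: ln_near_ge.
have yc : 2 / c <= ln x by near: x; exact: ln_near_ge.
have x0 : 0 < x by lra.
set y := ln x in y1 yc *; have y0 : 0 < y by lra.
apply: (@le_trans _ _ y); first by exact/ltW/ln_sublinear.
have -> : x = expR y by rewrite lnK.
have := @expR_ge1Dxn R y 1 (ltW y0).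
rewrite (_ : 2`!%:R = 2)// => H.
rewrite -ler_pdivrMl//; apply: le_trans H.
rewrite mulrC; move: yc; rewrite !ler_pdivrMr// => yc.
have : 2 * y <= y * c * y by rewrite ler_pM2r.
rewrite expr2; nra.
Unshelve. all: end_near. Qed.

(** [lil x ^ 2] is at least of order [x], and [ln x ^ 2] is negligible before it. *)
Lemma lil_near_ge_ln (c : R) : 0 < c -> \forall x \near +oo, 2 * ln x <= c * lil x.
Proof.
move=> c0; near=> x.
have x1 : 1 <= x by near: x; exact: nbhs_pinfty_ge.
have y1 : 1 <= ln x by near: x; exact: ln_near_ge.
have yc : 12 / (c ^+ 2 * v) <= ln x by near: x; exact: ln_near_ge.
have l1 : 1 <= ln (ln x) by near: x; exact: lnln_near_ge.
have x0 : 0 < x by lra.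
rewrite -(@ler_pXn2r _ 2) ?nnegrE ?mulr_ge0 ?lil_ge0 ?(ltW c0)//; last by lra.
rewrite !exprMn lil_sqr; [|lra|lra].
have xl : x <= x * ln (ln x) by rewrite ler_peMr// ltW.
have xy : ln x ^+ 3 <= 6 * x.
  have := @expR_ge1Dxn R (ln x) 2; rewrite lnK ?posrE// => /(_ ltac:(lra)).
  by rewrite (_ : 3`!%:R = 6)//; lra.
apply: (@le_trans _ _ (c ^+ 2 * (2 * v * x))); last first.
  by rewrite ler_pM2l ?exprn_gt0// ler_pM2l// mulr_gt0.
have c2v : 0 < c ^+ 2 * v by rewrite mulr_gt0// exprn_gt0.
move: yc; rewrite ler_pdivrMr// => yc.
have : 12 * ln x ^+ 2 <= ln x * (c ^+ 2 * v) * ln x ^+ 2.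
  by rewrite ler_wpM2r// sqr_ge0.
have -> : ln x * (c ^+ 2 * v) * ln x ^+ 2 = (c ^+ 2 * v) * ln x ^+ 3 by ring.
have : (c ^+ 2 * v) * ln x ^+ 3 <= (c ^+ 2 * v) * (6 * x) by rewrite ler_pM2l.
have -> : c ^+ 2 * (2 * v * x) = (c ^+ 2 * v) * (6 * x) / 3 by field.
lra.
Unshelve. all: end_near. Qed.

Lemma near_natr (Q : R -> Prop) : (\forall x \near +oo, Q x) ->
  \forall n \near \oo, Q n%:R.
Proof. by move=> H; exact: (@cvgr_idn R _ H). Qed.

End lil_normalization.

(** * Summability and the Borel-Cantelli lemma *)

Section summability.
Context {R : realType}.

Lemma nneseries_lty_bounded (f : nat -> R) (C : R) : (forall k, 0 <= f k) ->
  (forall n, \sum_(k < n) f k <= C) -> (\sum_(0 <= k <oo) (f k)%:E < +oo)%E.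
Proof.
move=> f0 fC; apply: (@le_lt_trans _ _ C%:E); last exact: ltry.
apply: lime_le.
  by apply: is_cvg_nneseries => k _ _; rewrite lee_fin.
near=> n; rewrite sumEFin lee_fin big_mkord; exact: fC.
Unshelve. all: end_near. Qed.

Let log_power (p a : R) (k : nat) : R := expR (- p * ln (k.+1%:R * a)).

(** The series of [(k a) ^ (- (1 + p))] telescopes against [(k a) ^ (- p)]. *)
Lemma nneseries_log_power_lty (p a : R) : 0 < p -> 0 < a ->
  (\sum_(0 <= k <oo) (expR (- (1 + p) * ln (k.+1%:R * a)))%:E < +oo)%E.
Proof.
move=> p0 a0.
have pa0 : 0 < p * a by rewrite mulr_gt0.
have u0 k : 0 < log_power p a k by exact: expR_gt0.
have step k : p * a * expR (- (1 + p) * ln (k.+2%:R * a)) <=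
    log_power p a k - log_power p a k.+1.
  have k1 : 0 < k.+1%:R * a by rewrite mulr_gt0.
  have k2 : 0 < k.+2%:R * a by rewrite mulr_gt0.
  have -> : p * a * expR (- (1 + p) * ln (k.+2%:R * a)) =
      p * (k.+2%:R)^-1 * log_power p a k.+1.
    rewrite mulNr mulrDl mul1r opprD expRD -mulNr -/(log_power p a k.+1).
    rewrite expRN lnK ?posrE//.
    have : k.+2%:R != 0 :> R by rewrite pnatr_eq0.
    by move: (log_power p a k.+1) (k.+2%:R) => u m m0; field; rewrite m0 gt_eqF.
  have -> : log_power p a k = log_power p a k.+1 *
      expR (p * (ln (k.+2%:R * a) - ln (k.+1%:R * a))).
    by rewrite /log_power -expRD; congr expR; ring.
  have : k.+2%:R^-1 <= ln (k.+2%:R * a) - ln (k.+1%:R * a).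
    rewrite -[leRHS]opprK lerNr opprB -ln_div ?posrE//.
    rewrite (_ : k.+1%:R * a / _ = 1 + - k.+2%:R^-1); last first.
      have : k.+2%:R != 0 :> R by rewrite pnatr_eq0.
      rewrite -[k.+2]addn1 natrD; move: (k.+1%:R) => m m0.
      by field; rewrite m0 gt_eqF.
    by apply: le_ln1Dx; rewrite ltrN2 invf_lt1// ltr1n.
  move=> /(ler_wpM2l (ltW p0)) H.
  have := expR_ge1Dx (p * (ln (k.+2%:R * a) - ln (k.+1%:R * a))).
  move=> E1; rewrite -subr_ge0.
  have : 0 <= log_power p a k.+1 *
      (expR (p * (ln (k.+2%:R * a) - ln (k.+1%:R * a))) - 1 - p * k.+2%:R^-1).
    rewrite mulr_ge0 ?(ltW (u0 _))// -addrA -opprD subr_ge0.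
    by apply: le_trans E1; rewrite lerD2l.
  by rewrite !mulrBr mulr1 [p * _ * _]mulrC.
pose b k := expR (- (1 + p) * ln (k.+1%:R * a)).
apply: (@nneseries_lty_bounded _ (b 0%N + log_power p a 0 / (p * a))).
  by move=> k; exact: expR_ge0.
have H n : \sum_(k < n) b k.+1 <= (log_power p a 0 - log_power p a n) / (p * a).
  elim: n => [|n IH]; first by rewrite big_ord0 subrr mul0r.
  rewrite big_ord_recr /=; apply: (le_trans (lerD IH (lexx _))).
  rewrite -lerBrDl -mulrBl ler_pdivlMr// mulrC; apply: le_trans (step n) _.
  by lra.
case=> [|n]; first by rewrite big_ord0 addr_ge0 ?expR_ge0// divr_ge0 ?expR_ge0// ltW.
rewrite big_ord_recl lerD2l; apply: le_trans (H n) _.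
by rewrite ler_pM2r ?invr_gt0// gerBl ltW.
Qed.

End summability.

Section borel_cantelli.
Context {d : measure_display} {T : measurableType d} {R : realType}.
Variable P : probability T R.

Lemma ae_eventually_not (E : nat -> set T) (b : nat -> R) :
  (forall k, measurable (E k)) -> (forall k, (P (E k) <= (b k)%:E)%E) ->
  (\sum_(0 <= k <oo) (b k)%:E < +oo)%E ->
  {ae P, forall w, \forall k \near \oo, ~ E k w}.
Proof.
move=> mE Pb sb.
have : P (lim_sup_set E) = 0.
  apply: lim_sup_set_cvg0 => //; apply: le_lt_trans sb.
  by apply: lee_nneseries => k *; [exact: measure_ge0|exact: Pb].
have mL : measurable (lim_sup_set E).
  by apply: bigcapT_measurable => n; exact: bigcup_measurable.
move=> /(negligibleP _ mL); apply: negligibleS => w /= H.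
move=> n _; apply: contrapT => nH; apply: H; exists n => // k nk Ek.
by apply: nH; exists k.
Qed.

End borel_cantelli.

(** * The upper half of the law of the iterated logarithm *)

Section upper_law.
Context {d : measure_display} {T : measurableType d} {R : realType}.
Variables (P : probability T R) (Y : nat -> {RV P >-> R}) (K v : R).
Hypothesis HY : centered_iid Y K v.
Local Notation psi := (mgf (Y 0%N)).

Lemma psi_near0 (e : R) : 0 < e < 1 -> exists2 t0, 0 < t0 &
  forall t, 0 <= t <= t0 ->
    expR ((1 - e) * (t ^+ 2 / 2 * v)) <= psi t <= expR ((1 + e) * (t ^+ 2 / 2 * v)).
Proof.
case: HY => _ _ K0 YK Yi Ym Y2 Yv v0 e01.
exact: (mgf_near0 K0 (YK 0%N) Yi Ym Y2 Yv v0 e01).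
Qed.

Lemma expR_natM_cvgy (h : R) : 0 < h -> expR (k%:R * h) @[k --> \oo] --> +oo.
Proof.
move=> h0; apply/cvgryPge => A; near=> k.
apply: le_trans (expR_ge1Dx _); apply: ler_wpDl => //.
by rewrite -ler_pdivrMr//; near: k; exact: nbhs_infty_ger.
Unshelve. all: end_near. Qed.

(** Along the blocks from [expR (k h)] to [expR ((k + 1) h)], where
    [expR h = 1 + e], the optimal exponent [t] in the maximal inequality gives
    the probability [(k h) ^ (- (1 + e / 2))]. *)
Lemma block_exceed (e : R) : 0 < e -> \forall k \near \oo,
  (P [set w | exists2 n, (n <= Num.truncn (expR (k.+1%:R * ln (1 + e))))%N &
      ((1 + e) * lil v (expR (k%:R * ln (1 + e))) <= walk Y 0 n w)%R] <=
  (expR (- (1 + e / 2) * ln (k%:R * ln (1 + e))))%:E)%E.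
Proof.
move=> e0; have v0 := iid_var_gt0 HY.
have h0 : 0 < ln (1 + e) by rewrite ln_gt0// ltrDl.
have e1 : 0 < 1 + e by lra.
(* chosen so that [(1 + e) * (1 - dl) = 1 + e / 2] *)
pose dl := e / (2 * (1 + e)).
have dl01 : 0 < dl < 1.
  by rewrite divr_gt0 ?mulr_gt0//= ltr_pdivrMr ?mulr_gt0// mul1r; lra.
have [t0 t00 psit0] := psi_near0 dl01.
have c0 : 0 < t0 ^+ 2 * v / 2 by rewrite divr_gt0// mulr_gt0// exprn_gt0.
near=> k; set Q := expR (k%:R * ln (1 + e)).
have Q0 : 0 < Q := expR_gt0 _.
have l0 : 0 <= ln (ln Q).
  by rewrite /Q; near: k; exact: (expR_natM_cvgy h0 (lnln_near_ge 0)).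
have lQ : ln (ln Q) <= t0 ^+ 2 * v / 2 * Q.
  by rewrite /Q; near: k; exact: (expR_natM_cvgy h0 (lnln_near_le c0)).
have <- : ln Q = k%:R * ln (1 + e) by rewrite expRK.
(* the minimizer of [- t * (1 + e) * lil v Q + (1 + e) * Q * t ^ 2 * v / 2] *)
pose t := lil v Q / (Q * v).
have tge0 : 0 <= t by rewrite divr_ge0 ?lil_ge0 ?mulr_ge0 ?ltW.
have lil2 := lil_sqr v0 (ltW Q0) l0.
have tt0 : t <= t0.
  rewrite ler_pdivrMr ?mulr_gt0//.
  rewrite -(@ler_pXn2r _ 2) ?nnegrE ?lil_ge0 ?mulr_ge0 ?(ltW t00) ?(ltW Q0) ?(ltW v0)//.
  rewrite lil2 !exprMn.
  have : 2 * v * Q * ln (ln Q) <= 2 * v * Q * (t0 ^+ 2 * v / 2 * Q).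
    by rewrite ler_pM2l// !mulr_gt0.
  by rewrite -!mulrA => /le_trans; apply; rewrite le_eqVlt; apply/orP; left; apply/eqP; field.
have /andP[_ psit] : expR ((1 - dl) * (t ^+ 2 / 2 * v)) <= psi t <=
    expR ((1 + dl) * (t ^+ 2 / 2 * v)) by apply: psit0; rewrite tge0.
apply: le_trans (maximal_inequality HY _ _ tge0) _; rewrite lee_fin.
set N := Num.truncn _.
have NQ : N%:R <= Q * (1 + e).
  rewrite (_ : Q * (1 + e) = expR (k.+1%:R * ln (1 + e))).
    by rewrite truncn_le expR_ge0.
  by rewrite -natr1 mulrDl mul1r expRD lnK ?posrE.
have psi0 : 0 <= psi t by apply: le_trans (psi_ge1 HY tge0).
apply: (@le_trans _ _ (expR (- (t * ((1 + e) * lil v Q))) *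
    expR (Q * (1 + e) * ((1 + dl) * (t ^+ 2 / 2 * v))))).
  rewrite ler_pM2l ?expR_gt0//.
  apply: (@le_trans _ _ (expR ((1 + dl) * (t ^+ 2 / 2 * v)) ^+ N)).
    by rewrite lerXn2r ?nnegrE ?expR_ge0.
  rewrite -expRM_natl ler_expR ler_wpM2r//; apply: mulr_ge0; last first.
    by apply: mulr_ge0; rewrite ?divr_ge0 ?sqr_ge0 ?(ltW v0).
  by move/andP: dl01 => [? _]; lra.
rewrite -expRD ler_expR le_eqVlt; apply/orP; left; apply/eqP.
rewrite (_ : t * ((1 + e) * lil v Q) = 2 * (1 + e) * ln (ln Q)); last first.
  have -> : t * ((1 + e) * lil v Q) = (1 + e) * lil v Q ^+ 2 / (Q * v).
    by rewrite /t; ring.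
  by rewrite lil2; field; rewrite !gt_eqF.
rewrite (_ : t ^+ 2 / 2 * v = ln (ln Q) / Q); last first.
  have -> : t ^+ 2 / 2 * v = lil v Q ^+ 2 / (Q * v) ^+ 2 / 2 * v.
    by rewrite /t expr_div_n.
  by rewrite lil2; field; rewrite !gt_eqF.
by rewrite /dl; field; rewrite !gt_eqF.
Unshelve. all: end_near. Qed.

Lemma upper_lil (e : R) : 0 < e ->
  {ae P, forall w, \forall n \near \oo, walk Y 0 n w <= (1 + e) * lil v n%:R}.
Proof.
move=> e0; have v0 := iid_var_gt0 HY.
have h0 : 0 < ln (1 + e) by rewrite ln_gt0// ltrDl.
have e1 : 0 < 1 + e by lra.
set h := ln (1 + e) in h0.
have [k0 _ Hk0] := block_exceed e0.
pose N k := Num.truncn (expR (k.+1%:R * h)).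
pose E k := [set w | exists2 n, (n <= N k)%N &
  (1 + e) * lil v (expR (k%:R * h)) <= walk Y 0 n w].
have := @ae_eventually_not _ _ _ P (fun j => E (j + k0.+1)%N)
  (fun j => expR (- (1 + e / 2) * ln (j.+1%:R * h))).
have e20 : 0 < e / 2 by rewrite divr_gt0.
move=> /(_ _ _ (nneseries_log_power_lty e20 h0)) H.
apply: filterS (H _ _); last 2 first.
- by move=> k; exact: measurable_exceed.
- move=> k; apply: le_trans (Hk0 (k + k0.+1)%N _) _.
    by rewrite /= (leq_trans _ (leq_addl _ _)).
  rewrite lee_fin ler_expR !mulNr lerN2 ler_wpM2l//; first by lra.
  rewrite ler_ln ?posrE ?mulr_gt0 ?ltr0n ?addnS// ler_wpM2r ?(ltW h0)//.
  by rewrite ler_nat ltnS leq_addr.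
move=> w [k1 _ Hk1]; near=> n.
have n1 : 1 <= n%:R :> R by near: n; exact: nbhs_infty_ger.
have nM : (k0.+1 + k1)%:R + h^-1 + 1 <= ln n%:R / h.
  rewrite ler_pdivlMr//; near: n; exact: (near_natr (ln_near_ge _)).
pose k := Num.truncn (ln n%:R / h).
have nh0 : 0 <= ln n%:R / h := divr_ge0 (ln_ge0 n1) (ltW h0).
have /andP[kn nk] : k%:R <= ln n%:R / h < k.+1%:R by exact: truncn_itv.
have n0 : 0 < n%:R :> R by lra.
have Qn : expR (k%:R * h) <= n%:R.
  by rewrite -[leRHS]lnK ?posrE// ler_expR -ler_pdivlMr.
have nN : (n <= N k)%N.
  rewrite /N truncn_ge_nat ?expR_ge0// -[leLHS]lnK ?posrE// ler_expR.
  by rewrite -ler_pdivrMr// ltW.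
have kM : (k0.+1 + k1)%:R + h^-1 <= k%:R.
  have : ln n%:R / h < k%:R + 1 by rewrite natr1.
  lra.
have hi0 : 0 < h^-1 by rewrite invr_gt0.
have kM' : (k0.+1 + k1 <= k)%N by rewrite -(ler_nat R); lra.
have : ~ E k w.
  have := Hk1 (k - k0.+1)%N; rewrite /= subnK; last by rewrite (leq_trans _ kM') ?leq_addr.
  by apply; rewrite leq_subRL ?(leq_trans _ kM') ?leq_addr.
move=> nE; have : walk Y 0 n w < (1 + e) * lil v (expR (k%:R * h)).
  by rewrite ltNge; apply/negP => H'; apply: nE; exists n.
move=> /ltW/le_trans; apply; rewrite ler_pM2l//; apply: lil_homo => //.
rewrite ler_expR -ler_pdivrMr// mul1r; apply: le_trans kM.
by rewrite lerDr.
Unshelve. all: end_near. Qed.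

End upper_law.

(** * Two-sided tails of the walk *)

Section two_sided_tails.
Context {d : measure_display} {T : measurableType d} {R : realType}.
Variables (P : probability T R) (Y : nat -> {RV P >-> R}) (K v : R).
Hypothesis HY : centered_iid Y K v.
Local Notation psi := (mgf (Y 0%N)).

Lemma integrable_step n : P.-integrable setT (EFin \o Y n).
Proof.
apply/integrableP; split; first by apply/measurable_EFinP; exact: measurable_funPT.
rewrite (integral_ident HY (f := fun x : R => `|x%:E|%E)).
- by have /integrableP[] := iid_integrable HY.
- by apply: measurableT_comp => //; exact/measurable_EFinP.
- by [].
Qed.

Lemma integral_step n : (\int[P]_w (Y n w)%:E = 0)%E.
Proof.
have -> : (0 = \int[P]_w (Y 0%N w)%:E)%E.
  apply/esym; rewrite -[LHS]fineK; first by rewrite [fine _](iid_mean HY).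
  exact: integrable_fin_num (iid_integrable HY).
rewrite -[LHS]/(\int[P]_w (EFin \o Y n) w)%E -[RHS]/(\int[P]_w (EFin \o Y 0%N) w)%E.
rewrite -!(@integral_distribution _ _ _ _ _ P) ?integrable_step//.
  by apply: eq_measure_integral => A mA _; apply: (iid_ident HY).
Qed.

Lemma integral_walk m l :
  P.-integrable setT (fun w => (walk Y m l w)%:E) /\
  (\int[P]_w (walk Y m l w)%:E = 0)%E.
Proof.
elim: l => [|l [Il El]].
  under eq_fun do rewrite walk0; split; first exact: integrable0.
  exact: integral0.
under eq_fun do rewrite walkS EFinD; split.
  exact: integrableD Il (integrable_step _).
by rewrite integralD//; [rewrite El integral_step adde0|exact: integrable_step].
Qed.

Lemma integrable_expR_walk m l t : 0 <= t ->
  P.-integrable setT (fun w => (expR (t * walk Y m l w))%:E).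
Proof.
move=> t0; apply/integrableP; split.
  apply/measurable_EFinP; apply: measurableT_comp => //.
  by apply: measurable_funM => //; exact: measurable_walk.
under eq_integral do rewrite gee0_abs ?lee_fin ?expR_ge0//.
by rewrite (integral_expR_walk HY)// ltry.
Qed.

(** As [expR u - 1 - u >= `|u| - 1] and the walk is centered, an exponential
    moment controls both tails. *)
Lemma two_sided_tail t y n : 0 < t -> 1 < t * y ->
  ((t * y - 1)%:E * P [set w | (y <= `|walk Y 0 n w|)%R] <= (psi t ^+ n - 1)%:E)%E.
Proof.
move=> t0 ty; pose S w := walk Y 0 n w.
pose g w := expR (t * S w) - 1 - t * S w.
have mS : measurable_fun setT S by exact: measurable_walk.
have mg : measurable_fun setT g.
  apply: measurable_funB; last exact: measurable_funM.
  by apply: measurable_funB => //; apply: measurableT_comp => //; exact: measurable_funM.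
have g0 w : 0 <= g w by rewrite /g -addrA -opprD subr_ge0 expR_ge1Dx.
have gS w : `|t * S w| - 1 <= g w.
  rewrite /g; have := expR_ge0 (t * S w); have := expR_ge1Dx (t * S w).
  have [u0|u0] := leP 0 (t * S w); last by rewrite ltr0_norm//; lra.
  rewrite ger0_norm// => u1 _; have := expR_ge_taylor2 (t * S w).
  rewrite (min_idPl _) ?mulr1; last by lra.
  have := sqr_ge0 (t * S w - 1); rewrite sqrrB; lra.
have [IS ES] := integral_walk 0 n.
have ItS : P.-integrable setT (fun w => (t * S w)%:E).
  by under eq_fun do rewrite EFinM; exact: (integrableZl measurableT t IS).
have I1 : P.-integrable setT (fun=> (1 : R)%:E) by exact: finite_measure_integrable_cst.
have Ie := @integrable_expR_walk 0 n t (ltW t0).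
have Eg : (\int[P]_w (g w)%:E = (psi t ^+ n - 1)%:E)%E.
  under eq_integral do rewrite EFinB EFinB.
  rewrite integralB//; last exact: (integrableB measurableT Ie I1).
  rewrite integralB// (integral_expR_walk HY) ?(ltW t0)//.
  under [X in (_ - X)%E]eq_integral do rewrite EFinM.
  rewrite (integralZl measurableT IS) ES mule0 sube0.
  by rewrite integral_cst//= probability_setT mule1 EFinB.
have ty1 : 0 < t * y - 1 by rewrite subr_gt0.
rewrite -Eg; apply: le_trans (markov_ge0 P mg g0 ty1).
apply: lee_wpmul2l; first by rewrite lee_fin ltW.
apply: le_measure; rewrite ?inE.
- by apply: measurable_superlevel; exact: measurableT_comp.
- exact: measurable_superlevel.
- move=> w /= yS; apply: le_trans (gS w); rewrite lerD2r normrM gtr0_norm//.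
  by rewrite ler_pM2l.
Qed.

End two_sided_tails.

(** * A lower bound for the probability of a large increment *)

(** The exponents, in units of [ln (ln x)], that occur in the window estimate
    for [ta = 1 - 2 r] between [xi = 1 - 3 r] and [et = 1 - r].  Completing squares
    leaves [- r ^ 2] outside the window; the errors [dl] cost at most half of it. *)
Lemma window_exponents (R : realType) (r : R) : 0 < r -> 4 * r < 1 ->
  let dl := r ^+ 2 / 8 in
  let ta := 1 - 2 * r in let xi := 1 - 3 * r in let et := 1 - r in
  [/\ ta ^+ 2 - r ^+ 2 / 4 <= (1 - dl) ^+ 2 * ta ^+ 2,
      2 * (ta - xi) * xi + (1 + dl) * xi ^+ 2 <= ta ^+ 2 - r ^+ 2 / 4 + - (r ^+ 2 / 2) /\
      - (2 * (et - ta) * et) + (1 + dl) * et ^+ 2 <= ta ^+ 2 - r ^+ 2 / 4 + - (r ^+ 2 / 2) &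
      [/\ 0 <= ta <= 1, 0 <= xi <= 1, 0 <= et <= 1, xi <= ta &
       [/\ ta <= et, 0 <= 1 - dl & 0 <= 1 + dl]]].
Proof.
move=> r0 r1 dl ta xi et.
have r20 : 0 < r ^+ 2 by rewrite exprn_gt0.
have r21 : r ^+ 2 < 1 by rewrite expr_lt1 ?ltW//; lra.
have dl0 : 0 <= dl by rewrite divr_ge0 ?ltW.
have ta01 : 0 <= ta <= 1 by rewrite /ta; apply/andP; split; lra.
have xi01 : 0 <= xi <= 1 by rewrite /xi; apply/andP; split; lra.
have et01 : 0 <= et <= 1 by rewrite /et; apply/andP; split; lra.
have dla a : 0 <= a <= 1 -> dl * a ^+ 2 <= dl.
  by move=> /andP[a0 a1]; rewrite ler_piMr// exprn_ile1.
have xta : xi <= ta by rewrite /xi /ta; lra.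
have tet : ta <= et by rewrite /et /ta; lra.
have dl1 : 0 <= 1 - dl by rewrite /dl; lra.
have dl2 : 0 <= 1 + dl by lra.
have sq a : (1 + dl) * a ^+ 2 = a ^+ 2 + dl * a ^+ 2 by ring.
split => //; last split.
- have -> : (1 - dl) ^+ 2 * ta ^+ 2 = ta ^+ 2 - 2 * (dl * ta ^+ 2) + (dl * ta) ^+ 2 by ring.
  have := dla ta ta01; have := sqr_ge0 (dl * ta).
  by move: (ta ^+ 2) (dl * ta ^+ 2) ((dl * ta) ^+ 2) => a b c; rewrite /dl; lra.
- rewrite sq; have := dla xi xi01; move: (dl * xi ^+ 2) => z.
  by rewrite /dl /ta /xi; lra.
- rewrite sq; have := dla et et01; move: (dl * et ^+ 2) => z.
  by rewrite /dl /ta /et; lra.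
Qed.

Lemma half_window (R : realType) (M q A B C : R) :
  M <= q -> A <= M / 4 -> B <= M / 4 -> q <= A + B + C -> M / 2 <= C.
Proof. lra. Qed.

Section block_lower_bound.
Context {d : measure_display} {T : measurableType d} {R : realType}.
Variables (P : probability T R) (Y : nat -> {RV P >-> R}) (K v : R).
Hypothesis HY : centered_iid Y K v.
Local Notation psi := (mgf (Y 0%N)).

(** The walk is of order [Num.sqrt (n * v)], which is negligible with respect to
    [lil v n] as [ln (ln n)] tends to infinity. *)
Lemma walk_lil_small (c b : R) : 0 < c -> 0 < b -> \forall n \near \oo,
  (P [set w | (c * lil v n%:R <= `|walk Y 0 n w|)%R] <= b%:E)%E.
Proof.
move=> c0 b0; have v0 := iid_var_gt0 HY.
have half01 : 0 < (2^-1 : R) < 1 by lra.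
have [t0 t00 psit0] := psi_near0 HY half01.
have A0 : 0 < ((1 + expR 1 / b) / c) ^+ 2 by rewrite exprn_gt0// divr_gt0// addr_gt0// divr_gt0 ?expR_gt0.
near=> n.
have n1 : 1 <= n%:R :> R by near: n; exact: nbhs_infty_ger.
have nt0 : (t0 ^+ 2 * v)^-1 <= n%:R by near: n; exact: nbhs_infty_ger.
have nl : ((1 + expR 1 / b) / c) ^+ 2 <= ln (ln n%:R).
  by near: n; exact: (near_natr (lnln_near_ge _)).
have n0 : 0 < n%:R :> R by lra.
pose t := (Num.sqrt (n%:R * v))^-1.
have nv0 : 0 < n%:R * v by rewrite mulr_gt0.
have tgt0 : 0 < t by rewrite invr_gt0 sqrtr_gt0.
have t2 : t ^+ 2 = (n%:R * v)^-1 by rewrite exprVn sqr_sqrtr ?ltW.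
have tt0 : t <= t0.
  rewrite -(@ler_pXn2r _ 2) ?nnegrE ?(ltW tgt0) ?(ltW t00)// t2.
  rewrite -[leRHS]invrK lef_pV2 ?posrE ?invr_gt0 ?exprn_gt0//.
  by move: nt0; rewrite invfM ler_pdivrMr.
have psile : psi t ^+ n <= expR 1.
  have /andP[_ H] : expR ((1 - 2^-1) * (t ^+ 2 / 2 * v)) <= psi t <=
    expR ((1 + 2^-1) * (t ^+ 2 / 2 * v)) by apply: psit0; rewrite (ltW tgt0).
  apply: (@le_trans _ _ (expR ((1 + 2^-1) * (t ^+ 2 / 2 * v)) ^+ n)).
    by rewrite lerXn2r ?nnegrE ?expR_ge0// (le_trans _ (psi_ge1 HY (ltW tgt0))).
  rewrite -expRM_natl ler_expR t2.
  have -> : n%:R * ((1 + 2^-1) * ((n%:R * v)^-1 / 2 * v)) = 3 / 4 :> R.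
    by field; rewrite !gt_eqF.
  lra.
have ly : 1 + expR 1 / b <= t * (c * lil v n%:R).
  have l0 : 0 <= ln (ln n%:R :> R) by apply: le_trans nl; exact: sqr_ge0.
  have e0 : 0 < 1 + expR 1 / b by rewrite addr_gt0// divr_gt0 ?expR_gt0.
  rewrite -(@ler_pXn2r _ 2) ?nnegrE ?mulr_ge0 ?lil_ge0 ?(ltW tgt0) ?(ltW c0) ?(ltW e0)//.
  rewrite !exprMn t2 lil_sqr// ?(ltW n0)//.
  have -> : (n%:R * v)^-1 * (c ^+ 2 * (2 * v * (n%:R * ln (ln n%:R)))) =
    2 * c ^+ 2 * ln (ln n%:R) by field; rewrite !gt_eqF.
  move: nl; rewrite expr_div_n ler_pdivrMr ?exprn_gt0//.
  have : 0 <= ln (ln n%:R :> R) * c ^+ 2 by rewrite mulr_ge0 ?sqr_ge0.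
  lra.
have eb0 : 0 < expR 1 / b by rewrite divr_gt0 ?expR_gt0.
have y1 : 1 < t * (c * lil v n%:R) by lra.
have := two_sided_tail HY n tgt0 y1.
have ty1 : 0 < t * (c * lil v n%:R) - 1 by lra.
rewrite -lee_pdivlMl// => /le_trans; apply.
rewrite lee_fin ler_pdivrMl//; apply: (@le_trans _ _ (expR 1)); first by lra.
by rewrite mulrC -ler_pdivrMl// mulrC; lra.
Unshelve. all: end_near. Qed.

(** Away from a window [x, y] the tilted mass is controlled by the moments at
    the neighbouring exponents [u] and [s], so that the window carries it. *)
Lemma tilted_window m l (u t s x y : R) : 0 <= u -> u <= t -> t <= s ->
  psi t ^+ l <= expR ((t - u) * x) * psi u ^+ l + expR (- ((s - t) * y)) * psi s ^+ l
     + expR (t * y) * fine (P [set w | x < walk Y m l w]).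
Proof.
move=> u0 ut ts; have t0 := le_trans u0 ut; have s0 := le_trans t0 ts.
pose V w := walk Y m l w; have mV : measurable_fun setT V by exact: measurable_walk.
have mE c : measurable_fun setT (fun w => expR (c * V w)).
  by apply: measurableT_comp => //; exact: measurable_funM.
pose A := [set w | x < V w].
have mA : measurable A by exact: measurable_strict_superlevel.
pose c1 := expR ((t - u) * x); pose c2 := expR (- ((s - t) * y)); pose c3 := expR (t * y).
have I (c a : R) : 0 <= c -> P.-integrable setT (fun w => (a * expR (c * V w))%:E) /\
    (\int[P]_w (a * expR (c * V w))%:E = (a * psi c ^+ l)%:E)%E.
  move=> c0; have Ic := integrable_expR_walk HY m l c0.
  have E w : ((a * expR (c * V w))%:E = a%:E * (expR (c * V w))%:E)%E by rewrite EFinM.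
  under eq_fun do rewrite E; split; first exact: (integrableZl measurableT a Ic).
  by rewrite (integralZl measurableT Ic) (integral_expR_walk HY)// EFinM.
have [It Et] := I t 1 t0.
have [Iu Eu] := I u c1 u0.
have [Is Es] := I s c2 s0.
have IA : P.-integrable setT (fun w => (c3 * \1_A w)%:E).
  under eq_fun do rewrite EFinM.
  apply: (integrableZl measurableT c3); apply: integrable_indic => //.
have EA : (\int[P]_w (c3 * \1_A w)%:E = (c3 * fine (P A))%:E)%E.
  under eq_integral do rewrite EFinM.
  have mi : measurable_fun setT (fun w => (\1_A w : R)%:E).
    by apply/measurable_EFinP; exact: measurable_indic.
  rewrite (ge0_integralZl P measurableT mi)//; last by rewrite lee_fin expR_ge0.
  by rewrite integral_indic// setIT EFinM fineK// fin_num_measure.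
have Ius : P.-integrable setT (fun w => (c1 * expR (u * V w))%:E + (c2 * expR (s * V w))%:E)%E.
  exact: integrableD.
rewrite -lee_fin -[in leLHS](mul1r (psi t ^+ l)) -Et !EFinD -Eu -Es -EA.
rewrite -(integralD measurableT Iu Is) -(integralD measurableT Ius IA).
apply: le_integral => //; first exact: integrableD.
move=> w _; rewrite -!EFinD lee_fin mul1r /c1 /c2 /c3 -!expRD.
(* each of the three terms dominates on one side of the window or in it *)
have [Vx|xV] := leP (V w) x.
  apply: ler_wpDr; first by rewrite mulr_ge0 ?expR_ge0.
  apply: ler_wpDr; first exact: expR_ge0.
  rewrite ler_expR -subr_ge0.
  have -> : (t - u) * x + u * V w - t * V w = (t - u) * (x - V w) by ring.
  by rewrite mulr_ge0// subr_ge0.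
have [yV|Vy] := leP y (V w).
  apply: ler_wpDr; first by rewrite mulr_ge0 ?expR_ge0.
  apply: ler_wpDl; first exact: expR_ge0.
  rewrite ler_expR -subr_ge0.
  have -> : - ((s - t) * y) + s * V w - t * V w = (s - t) * (V w - y) by ring.
  by rewrite mulr_ge0// subr_ge0.
apply: ler_wpDl; first by rewrite addr_ge0 ?expR_ge0.
rewrite indicE mem_set// mulr1 ler_expR ler_wpM2l//; exact: ltW.
Qed.

(** With [t], [u], [s] proportional to [1 - 2 r], [1 - 3 r], [1 - r] the window
    bound has exponent larger than [-1]; the slack absorbs the error terms. *)
Lemma block_lower (r : R) : 0 < r -> 4 * r < 1 -> \forall x \near +oo,
  forall m l : nat, (1 - r ^+ 2 / 8) * x <= l%:R <= x ->
  expR (- ln (ln x)) / 2 <=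
    fine (P [set w | (1 - 3 * r) * lil v x < walk Y m l w]).
Proof.
move=> r0 r1; have v0 := iid_var_gt0 HY.
have r20 : 0 < r ^+ 2 by rewrite exprn_gt0.
have r21 : r ^+ 2 < 1 by rewrite expr_lt1 ?ltW//; lra.
pose dl := r ^+ 2 / 8.
have dl01 : 0 < dl < 1 by rewrite /dl; apply/andP; split; lra.
have [t0 t00 psit0] := psi_near0 HY dl01.
have c0 : 0 < t0 ^+ 2 * v / 2 by rewrite divr_gt0// mulr_gt0// exprn_gt0.
pose ta := 1 - 2 * r; pose xi := 1 - 3 * r; pose et := 1 - r.
have [exta [exxi exet] [ta01 xi01 et01 xita [taet dl0 dl1]]] := window_exponents r0 r1.
have L4 (L : R) : 6 / r ^+ 2 <= L -> 4 <= 1 + r ^+ 2 / 2 * L.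
  by rewrite ler_pdivrMr// => ?; lra.
have r2 : 0 <= r * (2 - r / 4) by rewrite mulr_ge0 ?ltW//; lra.
near=> x => m l /andP[lx1 lx2].
have x0 : 0 < x by near: x; exact: nbhs_pinfty_gt.
have L0 : 0 <= ln (ln x) by near: x; exact: lnln_near_ge.
have Lx : ln (ln x) <= t0 ^+ 2 * v / 2 * x by near: x; exact: lnln_near_le.
have Lr : 6 / r ^+ 2 <= ln (ln x) by near: x; exact: lnln_near_ge.
set L := ln (ln x) in L0 Lx Lr *.
have lil2 : lil v x ^+ 2 = 2 * v * (x * L) by rewrite lil_sqr// ltW.
pose t := lil v x / (x * v).
have tge0 : 0 <= t by rewrite divr_ge0 ?lil_ge0 ?mulr_ge0 ?ltW.
have tt0 : t <= t0.
  rewrite ler_pdivrMr ?mulr_gt0//.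
  rewrite -(@ler_pXn2r _ 2) ?nnegrE ?lil_ge0 ?mulr_ge0 ?(ltW t00) ?(ltW x0) ?(ltW v0)//.
  rewrite lil2 !exprMn.
  have : 2 * v * x * L <= 2 * v * x * (t0 ^+ 2 * v / 2 * x).
    by rewrite ler_pM2l// !mulr_gt0.
  by rewrite -!mulrA => /le_trans; apply; rewrite le_eqVlt; apply/orP; left; apply/eqP; field.
have tlil : t * lil v x = 2 * L.
  have -> : t * lil v x = lil v x ^+ 2 / (x * v) by rewrite /t; ring.
  by rewrite lil2; field; rewrite !gt_eqF.
have t2 : t ^+ 2 / 2 * v = L / x.
  have -> : t ^+ 2 / 2 * v = lil v x ^+ 2 / (x * v) ^+ 2 / 2 * v.
    by rewrite /t expr_div_n.
  by rewrite lil2; field; rewrite !gt_eqF.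
have psib a : 0 <= a <= 1 ->
    expR ((1 - dl) ^+ 2 * a ^+ 2 * L) <= psi (a * t) ^+ l <= expR ((1 + dl) * a ^+ 2 * L).
  move=> /andP[a0 a1].
  have at0 : 0 <= a * t by rewrite mulr_ge0.
  have := psit0 (a * t); rewrite at0 (le_trans _ tt0) ?ler_piMl// => /(_ isT).
  have -> : (a * t) ^+ 2 / 2 * v = a ^+ 2 * (L / x) by rewrite exprMn -t2; ring.
  move=> /andP[lo up].
  have psi0 : 0 <= psi (a * t) by apply: le_trans (psi_ge1 HY at0).
  have aL0 : 0 <= a ^+ 2 * L by rewrite mulr_ge0 ?sqr_ge0.
  apply/andP; split.
    apply: (@le_trans _ _ (expR ((1 - dl) * (a ^+ 2 * (L / x))) ^+ l)); last first.
      by rewrite lerXn2r ?nnegrE ?expR_ge0.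
    rewrite -expRM_natl ler_expR.
    have -> : l%:R * ((1 - dl) * (a ^+ 2 * (L / x))) = (1 - dl) * (a ^+ 2 * L) * (l%:R / x) by ring.
    have -> : (1 - dl) ^+ 2 * a ^+ 2 * L = (1 - dl) * (a ^+ 2 * L) * (1 - dl) by ring.
    rewrite ler_wpM2l//; first exact: mulr_ge0.
    by rewrite ler_pdivlMr.
  apply: (@le_trans _ _ (expR ((1 + dl) * (a ^+ 2 * (L / x))) ^+ l)).
    by rewrite lerXn2r ?nnegrE ?expR_ge0.
  rewrite -expRM_natl ler_expR.
  have -> : l%:R * ((1 + dl) * (a ^+ 2 * (L / x))) = (1 + dl) * (a ^+ 2 * L) * (l%:R / x) by ring.
  rewrite -[leRHS]mulrA -[leRHS]mulr1 ler_wpM2l//.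
    exact: mulr_ge0.
  by rewrite ler_pdivrMr// mul1r.
have := @tilted_window m l (xi * t) (ta * t) (et * t) (xi * lil v x) (et * lil v x).
have H1 : 0 <= xi * t by rewrite mulr_ge0//; case/andP: xi01.
have H2 : xi * t <= ta * t by rewrite ler_wpM2r.
have H3 : ta * t <= et * t by rewrite ler_wpM2r.
move=> /(_ H1 H2 H3).
have -> : (ta * t - xi * t) * (xi * lil v x) = 2 * (ta - xi) * xi * L.
  by transitivity ((ta - xi) * xi * (t * lil v x)); [ring|rewrite tlil; ring].
have -> : (et * t - ta * t) * (et * lil v x) = 2 * (et - ta) * et * L.
  by transitivity ((et - ta) * et * (t * lil v x)); [ring|rewrite tlil; ring].
have -> : ta * t * (et * lil v x) = 2 * ta * et * L.
  by transitivity (ta * et * (t * lil v x)); [ring|rewrite tlil; ring].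
set p := fine _ => W.
have /andP[lo _] : expR ((1 - dl) ^+ 2 * ta ^+ 2 * L) <= psi (ta * t) ^+ l <=
  expR ((1 + dl) * ta ^+ 2 * L) by exact: psib.
have /andP[_ upx] : expR ((1 - dl) ^+ 2 * xi ^+ 2 * L) <= psi (xi * t) ^+ l <=
  expR ((1 + dl) * xi ^+ 2 * L) by exact: psib.
have /andP[_ upe] : expR ((1 - dl) ^+ 2 * et ^+ 2 * L) <= psi (et * t) ^+ l <=
  expR ((1 + dl) * et ^+ 2 * L) by exact: psib.
pose M := expR ((ta ^+ 2 - r ^+ 2 / 4) * L).
have loM : M <= psi (ta * t) ^+ l.
  by apply: le_trans lo; rewrite ler_expR ler_wpM2r.
have e14 : expR (- (r ^+ 2 / 2 * L)) <= 4^-1.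
  rewrite expRN lef_pV2 ?posrE ?expR_gt0//; apply: le_trans (expR_ge1Dx _).
  exact: L4.
have upxM : expR (2 * (ta - xi) * xi * L) * psi (xi * t) ^+ l <= M / 4.
  apply: (@le_trans _ _ (M * expR (- (r ^+ 2 / 2 * L)))); last by rewrite ler_wpM2l ?expR_ge0.
  apply: (le_trans (ler_wpM2l (expR_ge0 _) upx)).
  rewrite -!expRD ler_expR.
  rewrite -!(mulNr _ L) -!(mulrDl _ _ L); exact: ler_wpM2r.
have upeM : expR (- (2 * (et - ta) * et * L)) * psi (et * t) ^+ l <= M / 4.
  apply: (@le_trans _ _ (M * expR (- (r ^+ 2 / 2 * L)))); last by rewrite ler_wpM2l ?expR_ge0.
  apply: (le_trans (ler_wpM2l (expR_ge0 _) upe)).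
  rewrite -!expRD ler_expR.
  rewrite -!(mulNr _ L) -!(mulrDl _ _ L); exact: ler_wpM2r.
have {}W := half_window loM upxM upeM W.
rewrite -(ler_pM2l (expR_gt0 (2 * ta * et * L))); apply: le_trans W.
rewrite mulrA ler_pM2r ?invr_gt0// -expRD ler_expR -subr_ge0.
have -> : (ta ^+ 2 - r ^+ 2 / 4) * L - (2 * ta * et * L - L) =
  L * (r * (2 - r / 4)) by rewrite /ta /et; field.
by rewrite mulr_ge0.
Unshelve. all: end_near. Qed.

End block_lower_bound.

(** * The lower half of the law of the iterated logarithm *)

(** In the application [D j] is the probability that none of the first [j] trials
    succeeds; trial [j] has probability [p j], but only counts off an event of
    probability at most [b] that is independent of it.  When the sum of the [p j]
    diverges, [D] ends up below any bound larger than [b]. *)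
Lemma recurrence_decay (R : realType) (p D : nat -> R) (b : R) : (forall j, p j <= 1) ->
  D 0%N <= 1 -> 0 <= b -> (forall j, D j.+1 <= D j * (1 - p j) + p j * b) ->
  forall j, D j <= b + expR (- \sum_(i < j) p i).
Proof.
move=> p1 D0 b0 HD; elim=> [|j IH]; first by rewrite big_ord0 oppr0 expR0; lra.
apply: (le_trans (HD j)); rewrite big_ord_recr /= opprD expRD.
set E := expR (- \sum_(i < j) _) in IH *; have E0 : 0 <= E := expR_ge0 _.
have q0 : 0 <= 1 - p j by rewrite subr_ge0.
have : D j * (1 - p j) <= (b + E) * (1 - p j) by rewrite ler_wpM2r.
have : E * (1 - p j) <= E * expR (- p j) by rewrite ler_wpM2l// expR_ge1Dx.
lra.
Qed.

Lemma harmonic_ge_ln (R : realType) (k J : nat) :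
  ln (k.+1 + J)%:R - ln k.+1%:R <= \sum_(j < J) (k.+1 + j)%:R^-1 :> R.
Proof.
elim: J => [|J IH]; first by rewrite big_ord0 addn0 subrr.
rewrite big_ord_recr/= addnS; set a := (k.+1 + J)%N in IH *.
have a0 : 0 < a%:R :> R by rewrite ltr0n.
have : ln a.+1%:R - ln a%:R <= a%:R^-1 :> R.
  rewrite -ln_div ?posrE ?ltr0n// -natr1 mulrDl divff ?gt_eqF// mul1r.
  by apply: le_ln1Dx; rewrite (@lt_trans _ _ 0)// invr_gt0.
by move: IH; rewrite /=; lra.
Qed.

Lemma past_plus_block (R : realType) (r x y z : R) :
  (1 - 3 * r) * x < y -> - (r * x) <= z -> (1 - 4 * r) * x <= z + y.
Proof. lra. Qed.

Section lower_law.
Context {d : measure_display} {T : measurableType d} {R : realType}.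
Variables (P : probability T R) (Y : nat -> {RV P >-> R}) (K v : R).
Hypothesis HY : centered_iid Y K v.

Lemma measurable_stays_below (c : R) m :
  measurable [set w | forall n, (m <= n)%N -> walk Y 0 n w < c * lil v n%:R].
Proof.
rewrite (_ : [set _ | _] = \bigcap_(n in [set n | (m <= n)%N])
  [set w | walk Y 0 n w < c * lil v n%:R]); last by apply/seteqP; split.
apply: bigcap_measurableType => n _.
exact/measurable_strict_sublevel/measurable_walk.
Qed.

(** Second Borel-Cantelli argument along the geometric times [M ^ k]: the
    event at time [M ^ k.+1] is caused by the increment over the last block,
    which is independent of the past, unless the walk was low at time [M ^ k].
    Given the past, the increment fails to be large with probability [1 - p k],
    and [p k] is at least of order [1 / k]. *)
Lemma lower_lil_probability (r b : R) (m0 : nat) : 0 < r -> 4 * r < 1 -> 0 < b ->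
  (P [set w | forall n, (m0 <= n)%N -> (walk Y 0 n w < (1 - 4 * r) * lil v n%:R)%R]
    <= b%:E)%E.
Proof.
move=> r0 r1 b0; have v0 := iid_var_gt0 HY.
have r20 : 0 < r ^+ 2 by rewrite exprn_gt0.
(* a ratio so large that the last block is almost the whole past *)
pose M := (Num.truncn (8 / r ^+ 2)).+2.
have M8 : 8 / r ^+ 2 <= M%:R.
  rewrite ltW// (lt_le_trans (truncnS_gt _))// ler_nat; exact: leqnSn.
have M1 : 1 < M%:R :> R by rewrite ltr1n.
have M0 : 0 < M%:R :> R by lra.
have Mh : 0 < ln (M%:R : R) by rewrite ln_gt0.
have Mexp k : (M ^ k)%:R = expR (k%:R * ln M%:R) :> R.
  by rewrite natrX expRM_natl lnK ?posrE.
have Mcvg : ((M ^ k)%:R : R) @[k --> \oo] --> +oo.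
  by rewrite (_ : (fun k => _) = (fun k => expR (k%:R * ln M%:R)));
    [exact: expR_natM_cvgy|apply/funext => k; exact: Mexp].
have McvgS : ((M ^ k.+1)%:R : R) @[k --> \oo] --> +oo.
  by move: Mcvg; rewrite -(cvg_shiftS (fun k => (M ^ k)%:R : R)).
have Mcvgn : (M ^ k)%N @[k --> \oo] --> \oo by apply/cvgrnyP; exact: Mcvg.
pose len k := (M ^ k.+1 - M ^ k)%N.
have lenE k : (M ^ k + len k)%N = (M ^ k.+1)%N by rewrite subnKC// leq_pexp2l.
have b20 : 0 < b / 2 by rewrite divr_gt0.
pose A k := [set w | (1 - 3 * r) * lil v (M ^ k.+1)%:R < walk Y (M ^ k) (len k) w].
pose C k := [set w | r * lil v (M ^ k)%:R <= `|walk Y 0 (M ^ k) w|].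
have [k1 _ H1] := McvgS _ (block_lower HY r0 r1).
have [k2 _ H2] := Mcvgn _ (walk_lil_small HY r0 b20).
have [k3 _ H3] := Mcvgn _ (nbhs_infty_ge m0).
have [k4 _ H4] := Mcvg _ (nbhs_pinfty_ge (num_real (expR 1))).
pose k0 := (k1 + k2 + k3 + k4)%N.
have Hk0 k : (k0 <= k)%N -> [/\ expR (- ln (ln (M ^ k.+1)%:R)) / 2 <= fine (P (A k)),
    (P (C k) <= (b / 2)%:E)%E, (m0 <= M ^ k)%N & expR 1 <= (M ^ k)%:R :> R].
  rewrite /k0 => k0k; split; [|apply: (H2 k)|apply: (H3 k)|apply: (H4 k)] => /=; try lia.
  apply: (H1 k); first by rewrite /=; lia.
  rewrite natrB ?leq_pexp2l// gerBl ler0n andbT.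
  rewrite mulrBl mul1r lerD2l lerN2 expnS natrM mulrA ler_peMl//.
  by rewrite mulrAC ler_pdivlMr// mul1r mulrC -ler_pdivrMr.
(* no large increment in the first [j] blocks follows a negligible past *)
pose F := fix F j : set T := if j is j'.+1 then
  F j' `&` ~` (A (k0 + j')%N `\` C (k0 + j')%N) else setT.
have sA k : <<s cylinders Y [set i | (M ^ k <= i < M ^ k.+1)%N] >> (A k).
  apply: (@measurable_strict_superlevel _ (g_sigma_algebraType _)).
  by rewrite -(lenE k); exact: depends_on_walk.
have sC k : <<s cylinders Y [set i | (i < M ^ k)%N] >> (C k).
  apply: (@measurable_superlevel _ (g_sigma_algebraType _)).
  by apply: measurableT_comp => //; exact: (@depends_on_walk _ _ _ _ _ 0).
pose past k := g_sigma_algebraType (cylinders Y [set i | (i < M ^ k)%N]).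
have sF j : <<s cylinders Y [set i | (i < M ^ (k0 + j))%N] >> (F j).
  elim: j => [|j IH]; first exact: (@measurableT _ (past _)).
  have mono : [set i | (i < M ^ (k0 + j))%N] `<=` [set i | (i < M ^ (k0 + j.+1))%N].
    by move=> i /= /leq_trans; apply; rewrite leq_pexp2l// leq_add2l.
  apply: (@measurableI _ (past (k0 + j.+1)%N)).
    exact: sigma_cylindersS mono _ IH.
  apply: (@measurableC _ (past (k0 + j.+1)%N)); apply: (@measurableD _ (past (k0 + j.+1)%N)).
    apply: sigma_cylindersS (sA (k0 + j)%N) => i /= /andP[_].
    by rewrite addnS.
  exact: sigma_cylindersS mono _ (sC _).
have disj k : [set i | (i < M ^ k)%N] `&` [set i | (M ^ k <= i < M ^ k.+1)%N] = set0.
  by apply/seteqP; split => // i [/= ik /andP[ki _]]; move: ik; rewrite ltnNge ki.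
have mA k : measurable (A k) := sigma_cylinders_measurable (sA k).
have mC k : measurable (C k) := sigma_cylinders_measurable (sC k).
have mF j : measurable (F j) := sigma_cylinders_measurable (sF j).
have sAc k : <<s cylinders Y [set i | (M ^ k <= i < M ^ k.+1)%N] >> (~` A k).
  exact: (@measurableC _ (g_sigma_algebraType _) _ (sA k)).
pose p j := fine (P (A (k0 + j)%N)).
have pE j : P (A (k0 + j)%N) = (p j)%:E by rewrite fineK// fin_num_measure.
pose D j := fine (P (F j)).
have DE j : P (F j) = (D j)%:E by rewrite fineK// fin_num_measure.
have p1 j : p j <= 1 by rewrite -lee_fin -pE probability_le1.
have step j : D j.+1 <= D j * (1 - p j) + p j * (b / 2).
  rewrite -lee_fin -DE; set k := (k0 + j)%N.
  apply: (@le_trans _ _ (P ((F j `&` ~` A k) `|` (C k `&` A k)))).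
    apply: le_measure; rewrite ?inE//.
      apply: measurableU; apply: measurableI => //; exact: measurableC.
    move=> w [Fw nAC]; have [Aw|nAw] := pselect (A k w); last by left.
    by right; split=> //; apply: contrapT => nCw; exact: nAC.
  apply: (le_trans (measureU2 _ _ _)).
  - by apply: measurableI => //; exact: measurableC.
  - exact: measurableI.
  have e1 := sigma_indep (iid_indep HY) (disj k) (sF j) (sAc k).
  have e2 := sigma_indep (iid_indep HY) (disj k) (sC k) (sA k).
  rewrite EFinD; apply: leeD.
    by rewrite [leLHS]e1 probability_setC// pE DE -EFinB -EFinM.
  rewrite [leLHS]e2 pE muleC EFinM lee_wpmul2l//.
    by rewrite -pE measure_ge0.
  by have [] := Hk0 k (leq_addr _ _).
have D0 : D 0%N <= 1 by rewrite -lee_fin -DE probability_le1.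
have decay := recurrence_decay p1 D0 (ltW b20) step.
have GF j : [set w | forall n, (m0 <= n)%N -> walk Y 0 n w < (1 - 4 * r) * lil v n%:R]
    `<=` F j.
  elim: j => [//|j IH] w Gw; split; first exact: IH.
  set k := (k0 + j)%N => -[Aw nCw].
  have [_ _ mk ek] := Hk0 k (leq_addr _ _).
  have kS : (M ^ k <= M ^ k.+1)%N by rewrite leq_pexp2l.
  have := Gw (M ^ k.+1)%N (leq_trans mk kS); apply/negP; rewrite -leNgt.
  rewrite -[X in walk _ _ X](lenE k) walkD.
  have lilS : lil v (M ^ k)%:R <= lil v (M ^ k.+1)%:R.
    by apply: lil_homo => //; rewrite ler_nat.
  have low : - (r * lil v (M ^ k.+1)%:R) <= walk Y 0 (M ^ k) w.
    rewrite lerNl; apply: le_trans (ler_norm _) _; rewrite normrN.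
    move/negP: nCw; rewrite -ltNge => /ltW/le_trans; apply.
    by rewrite ler_pM2l.
  by have := past_plus_block Aw low.
pose c := (2 * ln (M%:R : R))^-1.
have c0 : 0 < c by rewrite invr_gt0 mulr_gt0.
have plow j : c * (k0.+1 + j)%:R^-1 <= p j.
  have [H _ _ _] := Hk0 (k0 + j)%N (leq_addr _ _).
  apply: le_trans H; rewrite Mexp expRK expRN lnK ?posrE ?mulr_gt0 ?ltr0n//.
  by rewrite /c addSn -!invfM le_eqVlt; apply/orP; left; apply/eqP; congr _^-1; ring.
have psum J : c * (ln (k0.+1 + J)%:R - ln k0.+1%:R) <= \sum_(j < J) p j.
  apply: (@le_trans _ _ (c * \sum_(j < J) (k0.+1 + j)%:R^-1)).
    by rewrite ler_pM2l// harmonic_ge_ln.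
  by rewrite mulr_sumr; apply: ler_sum.
have [J _ HJ] := near_natr (ln_near_ge (ln k0.+1%:R - ln (b / 2) / c)).
have {}HJ : ln k0.+1%:R - ln (b / 2) / c <= ln (k0.+1 + J)%:R :> R.
  by apply: (HJ (k0.+1 + J)%N); rewrite /= leq_addl.
apply: (@le_trans _ _ (P (F J))).
  apply: le_measure; rewrite ?inE//.
  exact: measurable_stays_below.
rewrite DE lee_fin; apply: (le_trans (decay J)).
have : expR (- \sum_(i < J) p i) <= b / 2; last by lra.
rewrite -[leRHS]lnK ?posrE// ler_expR lerNl; apply: le_trans (psum J).
rewrite [c * _]mulrC -ler_pdivrMr//; rewrite mulNr lerBrDr addrC; exact: HJ.
Qed.

Lemma lower_lil (e : R) : 0 < e < 1 ->
  {ae P, forall w, forall m, exists2 n, (m <= n)%N & (1 - e) * lil v n%:R <= walk Y 0 n w}.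
Proof.
move=> /andP[e0 e1]; apply: ae_foralln => m.
pose G := [set w | forall n, (m <= n)%N -> walk Y 0 n w < (1 - 4 * (e / 4)) * lil v n%:R].
have mG : measurable G by exact: measurable_stays_below.
have G0 : P G = 0.
  apply/eqP; rewrite eq_le measure_ge0 andbT; apply/lee_addgt0Pr => b b0.
  by rewrite add0e; apply: lower_lil_probability => //; lra.
apply: negligibleS (_ : P.-negligible G); last exact/negligibleP.
move=> w /= nH n mn; rewrite ltNge; apply/negP => H; apply: nH; exists n => //.
by move: H; rewrite (_ : 4 * (e / 4) = e)//; field.
Qed.

End lower_law.

(** * Limits superior and inferior of sequences *)

Section limits_superior.
Context {R : realType}.
Implicit Types (u : nat -> \bar R) (c : \bar R).
Local Open Scope ereal_scope.

Lemma limn_esupE u : limn_esup u = ereal_inf (range (esups u)).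
Proof. by rewrite limn_esup_lim; apply/cvg_lim => //; exact: cvg_esups_inf. Qed.

Lemma limn_einfE u : limn_einf u = ereal_sup (range (einfs u)).
Proof. by rewrite limn_einf_lim; apply/cvg_lim => //; exact: cvg_einfs_sup. Qed.

Lemma limn_esup_lt u c : limn_esup u < c -> \forall n \near \oo, u n < c.
Proof.
rewrite limn_esupE => /ereal_inf_lt[_ [N _ <-] Nc].
exists N => // n /= Nn; apply: le_lt_trans Nc; apply: ereal_sup_ubound.
by exists n.
Qed.

Lemma lt_limn_einf u c : c < limn_einf u -> \forall n \near \oo, c < u n.
Proof.
rewrite limn_einfE => /ereal_sup_gt[_ [N _ <-] Nc].
exists N => // n /= Nn; apply: lt_le_trans Nc _; apply: ereal_inf_lbound.
by exists n.
Qed.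

Lemma lt_limn_esup u c : c < limn_esup u -> forall m, exists2 n, (m <= n)%N & c < u n.
Proof.
move=> uc m; have : c < esups u m.
  by apply: lt_le_trans uc _; rewrite limn_esupE; apply: ereal_inf_lbound; exists m.
by move=> /ereal_sup_gt[_ [n mn <-] cn]; exists n.
Qed.

Lemma limn_esup_le u c : (\forall n \near \oo, u n <= c) -> limn_esup u <= c.
Proof.
move=> [N _ HN]; rewrite limn_esupE; apply: (@le_trans _ _ (esups u N)).
  by apply: ereal_inf_lbound; exists N.
by apply: ge_ereal_sup => _ [n Nn <-]; exact: HN.
Qed.

Lemma le_limn_esup u c : (forall m, exists2 n, (m <= n)%N & c <= u n) ->
  c <= limn_esup u.
Proof.
move=> H; rewrite limn_esupE; apply: le_ereal_inf_tmp => _ [m _ <-].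
have [n mn cn] := H m; apply: le_trans cn _; apply: ereal_sup_ubound.
by exists n.
Qed.

Lemma limn_einf_ge u c : (forall n, c <= u n) -> c <= limn_einf u.
Proof.
move=> H; rewrite limn_einfE; apply: (@le_trans _ _ (einfs u 0%N)); last first.
  by apply: ereal_sup_ubound; exists 0%N.
by apply: le_ereal_inf_tmp => _ [n _ <-].
Qed.

End limits_superior.

(** * Diagonal sequences *)

Section diagonal.

(** Partial sums of the individual thresholds increase and dominate each of
    them. *)
Lemma increasing_thresholds (Q : nat -> nat -> Prop) :
  (forall m, \forall n \near \oo, Q m n) ->
  exists2 N : nat -> nat, (forall i j, (i < j)%N -> (N i < N j)%N) &
    forall m n, (N m <= n)%N -> Q m n.
Proof.
move=> HQ; have [f Hf] := choice (fun m => let: ex_intro2 N _ H := HQ m in ex_intro _ N H).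
exists (fun m => \sum_(i < m.+1) (f i).+1)%N => [i j ij|m n].
  rewrite -(subnKC ij) -addSn; move: (j - i.+1)%N => k.
  rewrite addSn -addnS big_split_ord /= -[X in (X < _)%N]addn0 ltn_add2l.
  by rewrite big_ord_recl.
rewrite big_ord_recr /= => H; apply: Hf => /=; apply: leq_trans H.
by rewrite addnS ltnW// ltnS leq_addl.
Qed.

Variable N : nat -> nat.
Hypothesis N_homo : forall i j, (i < j)%N -> (N i < N j)%N.

Definition last_threshold (n : nat) : nat := \max_(m < n.+1 | (N m <= n)%N) m.

Lemma leq_threshold m : (m <= N m)%N.
Proof. by elim: m => // m IH; apply: leq_ltn_trans IH _; exact: N_homo. Qed.

Lemma last_threshold_ge m n : (N m <= n)%N -> (m <= last_threshold n)%N.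
Proof.
move=> mn; have mn1 : (m < n.+1)%N by rewrite ltnS (leq_trans (leq_threshold m)).
exact: (@leq_bigmax_cond _ (fun m : 'I_n.+1 => (N m <= n)%N) (fun m => m) (Ordinal mn1)).
Qed.

Lemma last_threshold_le n : (N 0 <= n)%N -> (N (last_threshold n) <= n)%N.
Proof.
move=> n0; rewrite /last_threshold.
have [|i Hi ->] := @eq_bigmax_cond _ (fun m : 'I_n.+1 => (N m <= n)%N) (fun m => m).
  by apply/card_gt0P; exists ord0.
exact: Hi.
Qed.

Lemma last_thresholdK m : last_threshold (N m) = m.
Proof.
apply/eqP; rewrite eqn_leq last_threshold_ge// andbT leqNgt.
apply/negP => /N_homo; rewrite ltnNge last_threshold_le//.
by case: m => // m; apply/ltnW/N_homo.
Qed.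

Lemma last_threshold_cvg : last_threshold n @[n --> \oo] --> \oo.
Proof.
by apply/cvgnyPge => m; exists (N m) => // n /=; exact: last_threshold_ge.
Qed.

End diagonal.

(** * Comparison of series with [1 / (n + 1) ^ 2] *)

Section series.
Context {R : realType}.

Lemma nneseries_near_le (f g : nat -> R) : (forall n, 0 <= f n) ->
  (forall n, 0 <= g n) -> (\forall n \near \oo, f n <= g n) ->
  (\sum_(0 <= n <oo) (g n)%:E < +oo)%E -> (\sum_(0 <= n <oo) (f n)%:E < +oo)%E.
Proof.
move=> f0 g0 [N _ fg] gy.
have gfin : (\sum_(0 <= n <oo) (g n)%:E)%E \is a fin_num.
  by rewrite ge0_fin_numE// nneseries_ge0// => n _ _; rewrite lee_fin.
apply: (@nneseries_lty_bounded _ _ (\sum_(k < N) f k + fine (\sum_(0 <= n <oo) (g n)%:E)%E)) => // n.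
apply: (@le_trans _ _ (\sum_(k < N) f k + \sum_(k < n) g k)).
  elim: n => [|n IH]; first by rewrite !big_ord0 addr0 sumr_ge0.
  have [nN|Nn] := ltnP n N.
    rewrite -[N](subnKC nN) big_split_ord/= -addrA lerDl addr_ge0// sumr_ge0//.
  by rewrite 2!big_ord_recr/= addrA lerD//; exact: fg.
rewrite lerD2l -lee_fin fineK// -sumEFin -(big_mkord xpredT (fun k => (g k)%:E)).
by apply: nneseries_lim_ge => k _ _; rewrite lee_fin.
Qed.

Lemma nneseries_lt_near1 (f : nat -> R) : (forall n, 0 <= f n) ->
  (\sum_(0 <= n <oo) (f n)%:E < +oo)%E -> \forall n \near \oo, f n < 1.
Proof.
move=> f0 fy; have f0E n : (0 <= (f n)%:E)%E by rewrite lee_fin.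
have /fine_cvgP[finT cvgT] := nneseries_tail_cvg fy (fun n _ => f0E n).
have T1 := cvgr_lt (0 : R) cvgT _ ltr01.
near=> n; rewrite -lte_fin.
apply: (@le_lt_trans _ _ (\sum_(n <= k <oo) (f k)%:E)%E).
  apply: (@le_trans _ _ (\sum_(n <= k < n.+1) (f k)%:E)%E); first by rewrite big_nat1.
  by apply: nneseries_lim_ge => k _ _.
rewrite -[ltLHS]fineK; last by near: n; exact: finT.
by rewrite lte_fin; near: n; exact: T1.
Unshelve. all: end_near. Qed.

Lemma nneseries_gauge : (\sum_(0 <= n <oo) (expR (- (2 * ln (n.+1%:R : R))))%:E < +oo)%E.
Proof.
have := @nneseries_log_power_lty R 1 1 ltr01 ltr01.
congr (_ < _)%E; apply: eq_eseriesr => n _.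
by rewrite mulr1 -mulNr.
Qed.

End series.

Section lil_powers.
Context {R : realType}.
Variable v : R.
Hypothesis v_gt0 : 0 < v.

Lemma lil_near_gt0 : \forall n \near \oo, 0 < lil v n%:R.
Proof.
near=> n; rewrite sqrtr_gt0 !mulr_gt0//.
  by near: n; exact: (near_natr (nbhs_pinfty_gt _)).
apply: (@lt_le_trans _ _ 1) => //.
by near: n; exact: (near_natr (lnln_near_ge _)).
Unshelve. all: end_near. Qed.

Lemma lil_near_ge_lnS (c : R) : 0 < c ->
  \forall n \near \oo, 2 * ln n.+1%:R <= c * lil v n%:R.
Proof.
move=> c0; have c20 : 0 < c / 2 by rewrite divr_gt0.
near=> n.
have H : 2 * ln n%:R <= c / 2 * lil v n%:R.
  by near: n; exact: (near_natr (lil_near_ge_ln v_gt0 c20)).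
have n2 : 2 <= n%:R :> R by near: n; exact: (near_natr (nbhs_pinfty_ge _)).
have : ln n.+1%:R <= 2 * ln n%:R :> R.
  have n0 : 0 < n%:R :> R by lra.
  rewrite [2 * _]mulr_natl [_ *+ 2]mulr2n -lnM ?posrE// ler_ln ?posrE ?ltr0n ?mulr_gt0//.
  rewrite -natr1; have : 0 <= (n%:R - 2) * n%:R :> R by rewrite mulr_ge0//; lra.
  lra.
lra.
Unshelve. all: end_near. Qed.

Lemma powR_inv_le x (s L : R) : 0 < L -> 0 <= x -> x `^ L^-1 <= expR s -> x <= expR (s * L).
Proof.
move=> L0 x0 H; rewrite expRM -(powRr1 x0) -(mulVf (lt0r_neq0 L0)) powRrM.
by apply: ge0_ler_powR => //; rewrite ?nnegrE ?powR_ge0 ?expR_ge0 ?(ltW L0).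
Qed.

Lemma powR_inv_ge x (s L : R) : 0 < L -> 0 <= x -> expR s <= x `^ L^-1 -> expR (s * L) <= x.
Proof.
move=> L0 x0 H; rewrite expRM -[leRHS](powRr1 x0) -(mulVf (lt0r_neq0 L0)) powRrM.
by apply: ge0_ler_powR => //; rewrite ?nnegrE ?powR_ge0 ?expR_ge0 ?(ltW L0).
Qed.

Lemma powR_inv_expR (s L : R) : 0 < L -> expR (s * L) `^ L^-1 = expR s.
Proof. by move=> L0; rewrite -expRM -mulrA mulfV ?mulr1// gt_eqF. Qed.

End lil_powers.

(** * Power series on the unit disc *)

Section analytic.
Context {R : realType}.

Lemma normc_ge0 (z : R[i]) : 0 <= normc z.
Proof. by case: z => x y; exact: sqrtr_ge0. Qed.

Lemma normr_Re_le (z : R[i]) : `|complex.Re z| <= normc z.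
Proof.
by case: z => x y /=; rewrite -sqrtr_sqr ler_sqrt ?lerDl ?sqr_ge0// addr_ge0 ?sqr_ge0.
Qed.

Lemma normr_Im_le (z : R[i]) : `|complex.Im z| <= normc z.
Proof.
by case: z => x y /=; rewrite -sqrtr_sqr ler_sqrt ?lerDr ?sqr_ge0// addr_ge0 ?sqr_ge0.
Qed.

Lemma normc_le_ReIm (z : R[i]) : normc z <= `|complex.Re z| + `|complex.Im z|.
Proof.
case: z => x y /=; rewrite -(@ler_pXn2r _ 2) ?nnegrE ?sqrtr_ge0 ?addr_ge0//.
rewrite sqr_sqrtr ?addr_ge0 ?sqr_ge0// sqrrD !real_normK ?num_real// lerD2r lerDl.
by rewrite mulrn_wge0// mulr_ge0.
Qed.

Lemma normc_real (x : R) : 0 <= x -> normc x%:C = x.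
Proof. by move=> x0; rewrite /= expr0n addr0 sqrtr_sqr ger0_norm. Qed.

Lemma normcX (z : R[i]) n : normc (z ^+ n) = normc z ^+ n.
Proof. by elim: n => [|n IH]; rewrite ?expr0 ?normc1// !exprS normcM IH. Qed.

(** Coefficients bounded by 1 give a series dominated by the geometric one on
    the unit disc; real and imaginary parts are summed separately. *)
Lemma analytic_series_le1 (a : nat -> R[i]) : (forall n, normc (a n) <= 1) ->
  analytic_series a.
Proof.
move=> a1; exists 1 => // z z1; pose u n := a n * z ^+ n.
have ule n : normc (u n) <= geometric 1 (normc z) n.
  rewrite /u normcM normcX /= mul1r.
  by rewrite ler_piMl// exprn_ge0// normc_ge0.
have cvg_part (f : R[i] -> R) : (forall w, `|f w| <= normc w) ->
    cvgn (series (fun n => f (u n))).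
  move=> fle; apply: (@normed_cvg _ R^o).
  apply: series_le_cvg (@is_cvg_geometric_series _ 1 (normc z) _).
  - by move=> n; exact: normr_ge0.
  - by move=> n /=; rewrite mul1r exprn_ge0// normc_ge0.
  - by move=> n; apply: le_trans (fle _) (ule n).
  - by rewrite ger0_norm// normc_ge0.
have /cvg_ex[x /cvgrPdist_lt Hx] := cvg_part _ normr_Re_le.
have /cvg_ex[y /cvgrPdist_lt Hy] := cvg_part _ normr_Im_le.
apply/cvg_ex; exists (x +i* y); apply/cvgrPdist_lt => e e0.
have eE : e = (complex.Re e)%:C.
  by move: e0; case: e => e1 e2; rewrite ltcE /= => /andP[/eqP -> _].
have e1 : 0 < complex.Re e / 2.
  by rewrite divr_gt0//; move: e0; case: (e) => ? ?; rewrite ltcE /= => /andP[].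
have ReS n : complex.Re (series u n) = series (fun n => complex.Re (u n)) n.
  by rewrite /series/= raddf_sum.
have ImS n : complex.Im (series u n) = series (fun n => complex.Im (u n)) n.
  by rewrite /series/= raddf_sum.
near=> n; rewrite eE.
have -> : `|(x +i* y : R[i]^o) - series u n| = (normc (x +i* y - series u n))%:C by [].
rewrite ltcR; apply: (le_lt_trans (normc_le_ReIm _)).
rewrite !raddfB/= ReS ImS.
rewrite -(divfK (lt0r_neq0 (ltr0n _ 2)) (complex.Re e)) mulr_natr mulr2n ltrD//.
  by near: n; exact: Hx.
by near: n; exact: Hy.
Unshelve. all: end_near. Qed.

End analytic.

(** * The logarithms of the factors *)

Section log_steps.
Context {d : measure_display} {T : measurableType d} {R : realType}.
Variables (P : probability T R) (X : nat -> {RV P >-> R}) (sigma M : R).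
Hypothesis X_nonneg : forall n, {ae P, forall w, 0 <= X n w}.
Hypothesis X_le : forall n, {ae P, forall w, X n w <= M}.
Hypothesis X_indep : mutually_independent X.
Hypothesis X_ident : identically_distributed X.
Hypothesis X_mean : (\int[P]_w lne (X 0%N w)%:E = 0)%E.
Hypothesis sigma_gt0 : 0 < sigma.
Hypothesis X_moment2 :
  (\int[P]_w (lne ((X 0%N w) ^+ 2)%:E) ^+ 2 = (sigma ^+ 2)%:E)%E.

Definition log_bound : R := Num.max 0 (ln M).

(** Truncating at [log_bound] changes nothing almost surely, and makes the
    steps bounded above at every point. *)
Definition trunc_ln (x : R) : R := Num.min (ln x) log_bound.

Lemma measurable_trunc_ln : measurable_fun setT trunc_ln.
Proof. by apply: measurable_minr => //; exact: measurable_ln. Qed.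

Lemma measurable_log_step n : measurable_fun setT (trunc_ln \o X n).
Proof. exact: measurableT_comp measurable_trunc_ln (measurable_funPT _). Qed.

Definition log_step (n : nat) : {RV P >-> R} := HB.pack (trunc_ln \o X n)
  (isMeasurableFun.Build _ _ _ _ (trunc_ln \o X n) (measurable_log_step n)).

Lemma measurable_lneE (g : T -> R) : measurable_fun setT g ->
  measurable_fun setT (fun w => lne (g w)%:E).
Proof.
move=> mg.
rewrite (_ : (fun w => _) = (fun w => if 0 < g w then (ln (g w))%:E else -oo%E)); last first.
  apply/funext => w; case: ltP => g0; first by rewrite lne_EFin.
  by rewrite le0_lneNy// lee_fin.
apply: measurable_fun_ifT => //; first exact: measurable_fun_ltr.
by apply/measurable_EFinP; exact: measurableT_comp (@measurable_ln R) mg.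
Qed.

Let measurable_X n : measurable_fun setT (X n) := measurable_funPT _.

Let measurable_sq : measurable_fun setT (fun w => (lne ((X 0%N w) ^+ 2)%:E ^+ 2)%E).
Proof.
under eq_fun do rewrite expe2.
by apply: emeasurable_funM; apply: measurable_lneE; exact: measurable_funX.
Qed.

(** At a zero of [X 0] the integrand of the second moment is infinite. *)
Lemma ae_X0_gt0 : {ae P, forall w, 0 < X 0%N w}.
Proof.
have If : P.-integrable setT (fun w => (lne ((X 0%N w) ^+ 2)%:E ^+ 2)%E).
  apply/integrableP; split => //.
  under eq_integral do rewrite gee0_abs ?expe2 ?sqre_ge0//.
  by under eq_integral do rewrite -expe2; rewrite X_moment2 ltry.
have := integrable_ae measurableT If.
apply: filterS2 (X_nonneg 0%N) => w X0 /(_ I) fin.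
rewrite lt_neqAle X0 andbT; apply/eqP => Xe; move: fin.
by rewrite -Xe expr0n le0_lneNy ?lee_fin// expe2.
Qed.

Lemma ae_X_gt0 n : {ae P, forall w, 0 < X n w}.
Proof.
have E k : ~` [set w | 0 < X k w] = X k @^-1` `]-oo, 0].
  by apply/seteqP; split => w /=; rewrite in_itv/= leNgt => /negP.
have mE k : measurable (X k @^-1` `]-oo, 0]).
  by rewrite -[Y in measurable Y]setTI; exact: measurable_X.
have : P (X 0%N @^-1` `]-oo, 0]) = 0.
  by apply/negligibleP => //; rewrite -E; exact: ae_X0_gt0.
move=> P0; change (P.-negligible (~` [set w | 0 < X n w])).
by rewrite E; apply/negligibleP => //; rewrite -P0; exact: (X_ident n).
Qed.

Lemma ae_log_step n : {ae P, forall w, 0 < X n w /\ log_step n w = ln (X n w)}.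
Proof.
apply: filterS2 (ae_X_gt0 n) (X_le n) => w X0 XM; split => //.
apply/min_idPl; rewrite le_max; apply/orP; right.
by rewrite ler_ln ?posrE// (lt_le_trans X0).
Qed.

Lemma log_step_indep : mutually_independent log_step.
Proof.
move=> J B mB.
have := X_indep (J := J) (B := fun i => trunc_ln @^-1` B i).
apply => i iJ; rewrite -[Y in measurable Y]setTI.
by apply: measurable_trunc_ln => //; exact: mB.
Qed.

Lemma log_step_ident : identically_distributed log_step.
Proof.
move=> n B mB; have := X_ident n (B := trunc_ln @^-1` B); apply.
by rewrite -[Y in measurable Y]setTI; exact: measurable_trunc_ln.
Qed.

Let v := sigma ^+ 2 / 4.

Let integral_log_step2 : (\int[P]_w (log_step 0%N w ^+ 2)%:E = v%:E)%E.
Proof.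
transitivity (\int[P]_w (4^-1%:E * (lne ((X 0%N w) ^+ 2)%:E ^+ 2)))%E.
  apply: ae_eq_integral => //.
  - by apply/measurable_EFinP; apply: measurable_funX; exact: measurable_log_step.
  - exact: emeasurable_funM.
  apply: filterS (ae_log_step 0%N) => w [X0 E] _.
  rewrite E lne_EFin ?exprn_gt0// lnXn// -EFin_expe -EFinM; congr EFin.
  by rewrite -mulr_natl; field.
rewrite ge0_integralZl//; last by move=> w _; rewrite expe2 sqre_ge0.
by rewrite X_moment2 -EFinM /v mulrC.
Qed.

Lemma log_step_iid : centered_iid log_step log_bound v.
Proof.
have v0 : 0 < v by rewrite divr_gt0// exprn_gt0.
have mY := measurable_log_step 0%N.
have I2 : P.-integrable setT (fun w => (log_step 0%N w ^+ 2)%:E).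
  apply/integrableP; split.
    by apply/measurable_EFinP; exact: measurable_funX.
  under eq_integral do rewrite gee0_abs ?lee_fin ?sqr_ge0//.
  by rewrite integral_log_step2 ltry.
have I1 : P.-integrable setT (EFin \o log_step 0%N).
  have Ic : P.-integrable setT (fun=> (1 : R)%:E) by exact: finite_measure_integrable_cst.
  apply: le_integrable (integrableD measurableT Ic I2) => //.
    exact/measurable_EFinP.
  move=> w _; rewrite -EFinD !abse_EFin lee_fin [leRHS]ger0_norm ?addr_ge0 ?sqr_ge0//.
  move: (log_step 0%N w) => y.
  have := sqr_ge0 (`|y| - 1); rewrite sqrrB real_normK ?num_real// expr1n mulr1.
  by have := normr_ge0 y; lra.
split => //.
- exact: log_step_indep.
- exact: log_step_ident.
- by rewrite le_max lexx.
- by move=> n w; rewrite ge_min lexx orbT.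
- rewrite /Rintegral (_ : (\int[P]_w _)%E = 0%E)// -X_mean.
  apply: ae_eq_integral => //; first exact/measurable_EFinP.
    exact: measurable_lneE.
  by apply: filterS (ae_log_step 0%N) => w [X0 E] _; rewrite E lne_EFin.
- by rewrite /Rintegral integral_log_step2.
Qed.

Lemma ae_weight : {ae P, forall w, forall n, weight X n w = expR (walk log_step 0 n w)}.
Proof.
apply: filterS (ae_foralln ae_log_step) => w H n.
elim: n => [|n IH]; first by rewrite /weight big_ord0 walk0 expR0.
have [X0 E] := H n.
rewrite walkS expRD -IH /weight big_ord_recr/= add0n; congr (_ * _).
by rewrite [trunc_ln _]E lnK.
Qed.

End log_steps.

(** * Membership in the space *)

Lemma log_decay (R : realType) (q t x y z : R) : q * y <= 0 -> x <= t * y ->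
  2 * z <= t * y -> 0 <= z -> (q - 2 * t) * y + x <= - z.
Proof. lra. Qed.

Lemma critical_log_decay (R : realType) (t x y z : R) : x <= (1 + t) * y ->
  2 * z <= t * y -> 0 <= z -> - (1 + 2 * t) * y + x <= - z.
Proof. lra. Qed.

Section hardy.
Context {d : measure_display} {T : measurableType d} {R : realType}.
Variables (P : probability T R) (Y : nat -> {RV P >-> R}) (K v : R).
Hypothesis HY : centered_iid Y K v.
Variable X : nat -> {RV P >-> R}.
Hypothesis HX : {ae P, forall w, forall n, weight X n w = expR (walk Y 0 n w)}.
Local Notation S n w := (walk Y 0 n w).
Local Notation L n := (lil v n%:R).
Implicit Types a : nat -> R[i].

Let v_gt0 : 0 < v := iid_var_gt0 HY.

(** Comparing the terms of the norm with [1 / (n + 1) ^ 2] is enough for all the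
    memberships below. *)
Lemma Hstar_eventually_le a :
  {ae P, forall w, \forall n \near \oo, normc (a n) * expR (S n w) <= expR (- ln n.+1%:R)} ->
  Hstar X a.
Proof.
apply: filterS2 HX => w Xw aw; rewrite /random_hardy /hardy_norm2 /=.
apply: (nneseries_near_le _ _ _ (@nneseries_gauge R)).
- by move=> n; rewrite mulr_ge0 ?sqr_ge0.
- by move=> n; exact: expR_ge0.
- apply: filterS aw => n an; rewrite Xw -exprMn -mulrN mulr_natl mulr2n expRD -expr2.
  by rewrite lerXn2r ?nnegrE ?expR_ge0// mulr_ge0 ?expR_ge0 ?normc_ge0.
Qed.

Lemma Hstar_eventually_lt1 a : Hstar X a ->
  {ae P, forall w, \forall n \near \oo, normc (a n) * expR (S n w) < 1}.
Proof.
apply: filterS2 HX => w Xw; rewrite /random_hardy /hardy_norm2 /= => /nneseries_lt_near1.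
move=> /(_ (fun n => mulr_ge0 (sqr_ge0 _) (sqr_ge0 _))).
apply: filterS => n; rewrite Xw -exprMn expr_lt1// mulr_ge0 ?expR_ge0 ?normc_ge0//.
Qed.

Lemma ae_false : ~ {ae P, forall w, False}.
Proof.
move=> H; have /negligibleP : P.-negligible [set: T].
  by apply: negligibleS H => w _ [].
move=> /(_ measurableT) P0; have := @probability_setT _ _ _ P.
by rewrite [LHS]P0 => /eqP; rewrite eq_sym onee_eq0.
Qed.

Lemma Hstar_lil_decay (s : R) a : 1 < s ->
  (\forall n \near \oo, normc (a n) <= expR (- s * L n)) -> Hstar X a.
Proof.
move=> s1 ha; apply: Hstar_eventually_le.
have e0 : 0 < (s - 1) / 2 by rewrite divr_gt0// subr_gt0.
apply: filterS (upper_lil HY e0) => w hS; near=> n.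
have h1 : normc (a n) <= expR (- s * L n) by near: n.
have h2 : S n w <= (1 + (s - 1) / 2) * L n by near: n.
have h3 : 2 * ln n.+1%:R <= (s - 1) / 2 * L n.
  by near: n; exact: (lil_near_ge_lnS v_gt0 e0).
have h4 : 0 <= ln n.+1%:R :> R by rewrite ln_ge0// ler1n.
apply: (@le_trans _ _ (expR (- s * L n) * expR ((1 + (s - 1) / 2) * L n))).
  by rewrite ler_pM ?expR_ge0 ?normc_ge0// ler_expR.
by rewrite -expRD ler_expR; lra.
Unshelve. all: end_near. Qed.

Lemma notin_Hstar_lil_lower (s : R) a : 0 < s < 1 ->
  (\forall n \near \oo, expR (- s * L n) <= normc (a n)) -> ~ Hstar X a.
Proof.
move=> /andP[s0 s1] [N _ ha] /Hstar_eventually_lt1 H; apply: ae_false.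
have e01 : 0 < 1 - s < 1 by apply/andP; split; lra.
apply: filterS2 H (lower_lil HY e01) => w [M _ HM] /(_ (N + M)%N)[n NMn hS].
have := HM n (leq_trans (leq_addl _ _) NMn); apply/negP; rewrite -leNgt.
rewrite -(expR0 R) -(addNr (s * L n)) expRD -mulNr.
apply: ler_pM; rewrite ?expR_ge0//.
  by apply: ha; rewrite /= (leq_trans (leq_addr _ _) NMn).
by rewrite ler_expR; move: hS; rewrite opprB addrC subrK.
Qed.

(** [|S n| < s * L n] has probability tending to 1, hence almost surely holds at
    infinitely many of the times where the coefficient is large. *)
Lemma notin_Hstar_lil_upper (s : R) a : 0 < s ->
  (forall m, exists2 n, (m <= n)%N & expR (s * L n) <= normc (a n)) -> ~ Hstar X a.
Proof.
move=> s0 ha /Hstar_eventually_lt1 H; apply: ae_false.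
pose I m := [set n | (m <= n)%N /\ expR (s * L n) <= normc (a n)].
pose Z m := \bigcap_(n in I m) [set w | s * L n <= `|S n w|].
have mS n : measurable [set w | s * L n <= `|S n w|].
  by apply: measurable_superlevel; apply: measurableT_comp => //; exact: measurable_walk.
have mZ m : measurable (Z m) by apply: bigcap_measurableType.
have Z0 m : P (Z m) = 0.
  apply/eqP; rewrite eq_le measure_ge0 andbT; apply/lee_addgt0Pr => b b0.
  rewrite add0e; have [N _ HN] := walk_lil_small HY s0 b0.
  have [n Nn an] := ha (N + m)%N.
  apply: le_trans (HN n (leq_trans (leq_addr _ _) Nn)); apply: le_measure; rewrite ?inE//.
  move=> w; apply; split => //; exact: leq_trans (leq_addl _ _) Nn.
have nZ : {ae P, forall w, forall m, ~ Z m w}.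
  apply: ae_foralln => m; apply: negligibleS (_ : P.-negligible (Z m)).
    by move=> w /= /contrapT.
  exact: (proj2 (negligibleP P (mZ m)) (Z0 m)).
apply: filterS2 H nZ => w [M _ HM] /(_ M); apply => n [Mn an].
have := HM n Mn; apply: contraTT; rewrite -ltNge -leNgt => hS.
rewrite -(expR0 R) -(addrN (s * L n)) expRD.
apply: ler_pM; rewrite ?expR_ge0// ler_expR lerNl.
by apply: le_trans (ltW hS); rewrite -normrN ler_norm.
Qed.

Lemma lil_root_expR (g : R) n : 0 < L n -> normc (expR (g * L n))%:C `^ (L n)^-1 = expR g.
Proof. by move=> L0; rewrite normc_real ?expR_ge0// powR_inv_expR. Qed.

(** The coefficients are supported on times [N m] so sparse that, by the
    Borel-Cantelli lemma, almost surely [|S (N m)| < L (N m) / (m + 1)] eventually.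
    Then the factor [expR (- 2 L (N m) / (m + 1))] ensures summability and
    does not affect the limit superior. *)
Lemma sparse_Hstar (c : R) : 0 < c <= 1 -> exists a : nat -> R[i],
  [/\ forall n, normc (a n) <= 1, Hstar X a &
      limn_esup (fun n => (normc (a n) `^ (L n)^-1)%:E) = c%:E].
Proof.
move=> /andP[c0 c1]; have lc : ln c <= 0 by rewrite ln_le0.
pose dl (m : nat) : R := m.+1%:R^-1.
have dl0 m : 0 < dl m by rewrite invr_gt0.
pose b (m : nat) : R := expR (- (2 * ln m.+1%:R)).
have b0 m : 0 < b m by exact: expR_gt0.
have [N Ninc HN] := @increasing_thresholds
  (fun m n => (P [set w | (dl m * L n <= `|S n w|)%R] <= (b m)%:E)%E /\
     2 * ln n.+1%:R <= dl m * L n)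
  (fun m => filterI (walk_lil_small HY (dl0 m) (b0 m)) (lil_near_ge_lnS v_gt0 (dl0 m))).
pose mu := last_threshold N.
pose g n := ln c - 2 * dl (mu n).
pose al n : R := if N (mu n) == n then expR (g n * L n) else 0.
have gle n : g n * L n <= 0.
  rewrite mulr_le0_ge0 ?lil_ge0// /g; have := dl0 (mu n); lra.
have al0 n : 0 <= al n by rewrite /al; case: ifP => // _; exact: expR_ge0.
exists (fun n => (al n)%:C); split.
- move=> n; rewrite normc_real// /al; case: ifP => // _.
  by rewrite -[leRHS](expR0 R) ler_expR.
- apply: Hstar_eventually_le.
  have mE m : measurable [set w | dl m * L (N m) <= `|S (N m) w|].
    by apply: measurable_superlevel; apply: measurableT_comp => //; exact: measurable_walk.
  have := ae_eventually_not mE (fun m => (HN m (N m) (leqnn _)).1) (@nneseries_gauge R).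
  apply: filterS => w [M _ HM]; near=> n.
  rewrite normc_real// /al; case: ifPn => [/eqP Nn|_]; last by rewrite mul0r expR_ge0.
  have Mn : (M <= mu n)%N.
    by near: n; exact: (last_threshold_cvg Ninc (nbhs_infty_ge M)).
  have /negP := HM _ Mn; rewrite /= Nn -ltNge => hS.
  have [_ hg] := HN (mu n) n (eq_leq Nn).
  rewrite -expRD ler_expR; apply: log_decay hg _.
  - by rewrite mulr_le0_ge0 ?lil_ge0.
  - exact: le_trans (ler_norm _) (ltW hS).
  - by rewrite ln_ge0// ler1n.
- apply/eqP; rewrite eq_le; apply/andP; split.
    apply: limn_esup_le; near=> n.
    have Ln : 0 < L n by near: n; exact: lil_near_gt0.
    rewrite lee_fin /al; case: ifP => _.
      by rewrite lil_root_expR// -[leRHS]lnK ?posrE// ler_expR /g gerBl mulr_ge0// ltW.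
    by rewrite normc_real// powR0 ?ltW// invr_neq0// gt_eqF.
  apply/lee_addgt0Pr => e e0; rewrite -leeBlDr// -EFinB.
  apply: le_limn_esup => m0.
  have Ncvg : N m @[m --> \oo] --> \oo.
    by apply/cvgnyPge => A; exists A => // m /= Am; exact: leq_trans Am (leq_threshold Ninc m).
  have [m [m0m me Lm]] : exists m, [/\ (m0 <= m)%N, 2 / e <= m.+1%:R & 0 < L (N m)].
    near \oo => m; exists m; split; near: m.
    - exact: nbhs_infty_ge.
    - near=> m; apply: (@le_trans _ _ m%:R); last by rewrite ler_nat.
      by near: m; exact: nbhs_infty_ger.
    - exact: (Ncvg _ (lil_near_gt0 v_gt0)).
  exists (N m); first exact: leq_trans m0m (leq_threshold Ninc m).
  have muN : mu (N m) = m by exact: last_thresholdK.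
  rewrite lee_fin /al muN eqxx lil_root_expR// /g muN expRD lnK ?posrE//.
  have dle : 2 * dl m <= e by rewrite /dl ler_pdivrMr ?ltr0n// mulrC -ler_pdivrMr.
  have H := expR_ge1Dx (- (2 * dl m)).
  apply: (@le_trans _ _ (c * (1 - 2 * dl m))); last by rewrite ler_pM2l.
  rewrite mulrBr mulr1 lerD2l lerN2; apply: le_trans dle.
  by rewrite ler_piMl// mulr_ge0// ltW.
Unshelve. all: end_near. Qed.

(** For each [m] the upper law gives [S n <= (1 + 1 / (m + 1)) * L n] for all [n >= N m]
    with probability close to 1.  Letting [m] grow with [n] as slowly as the
    thresholds [N m] require, the exponent decreases to its critical value 1. *)
Lemma critical_Hstar : exists a : nat -> R[i],
  [/\ forall n, normc (a n) <= 1, Hstar X a &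
      limn_einf (fun n => (normc (a n) `^ (L n)^-1)%:E) = (expR (-1))%:E].
Proof.
pose dl (m : nat) : R := m.+1%:R^-1.
have dl0 m : 0 < dl m by rewrite invr_gt0.
pose b (m : nat) : R := expR (- (2 * ln m.+1%:R)).
have b0 m : 0 < b m by exact: expR_gt0.
pose E m k := [set w | (1 + dl m) * L k < S k w].
have mE m k : measurable (E m k).
  exact/measurable_strict_superlevel/measurable_walk.
pose U m n := \bigcup_(k >= n) E m k.
have mU m n : measurable (U m n) by exact: bigcup_measurable.
have PU m : \forall n \near \oo, (P (U m n) <= (b m)%:E)%E.
  have L0 : P (lim_sup_set (E m)) = 0.
    apply/negligibleP; first by apply: bigcapT_measurable => n; exact: mU.
    apply: negligibleS (upper_lil HY (dl0 m)) => w /= Ew [n _ nw].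
    have [k nk] := Ew n I; have := nw k nk; rewrite /E /= => H1.
    by rewrite ltNge H1.
  have fin : (P (\bigcup_(k >= 0) E m k) < +oo)%E.
    by rewrite ltey_eq fin_num_measure//; exact: (mU m 0%N).
  have := lim_sup_set_cvg P (E m) (mE m) fin.
  rewrite [X in _ --> X](L0 : _ = 0%E) => /fine_cvgP[fU cU].
  have U1 := cvgr_lt (0 : R) cU _ (b0 m).
  near=> n; rewrite -[leLHS]fineK; last by near: n; exact: fU.
  by rewrite lee_fin; apply: ltW; near: n; exact: U1.
have [N Ninc HN] := @increasing_thresholds
  (fun m n => (P (U m n) <= (b m)%:E)%E /\ 2 * ln n.+1%:R <= dl m * L n)
  (fun m => filterI (PU m) (lil_near_ge_lnS v_gt0 (dl0 m))).
pose mu := last_threshold N.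
have mucvg : mu n @[n --> \oo] --> \oo := last_threshold_cvg Ninc.
pose g n := - (1 + 2 * dl (mu n)).
exists (fun n => (expR (g n * L n))%:C); split.
- move=> n; rewrite normc_real ?expR_ge0// -[leRHS](expR0 R) ler_expR.
  by rewrite mulr_le0_ge0 ?lil_ge0// /g; have := dl0 (mu n); lra.
- apply: Hstar_eventually_le.
  have := ae_eventually_not (fun m => mU m (N m))
    (fun m => (HN m (N m) (leqnn _)).1) (@nneseries_gauge R).
  apply: filterS => w [M _ HM]; near=> n.
  rewrite normc_real ?expR_ge0//.
  have Mn : (M <= mu n)%N by near: n; exact: (mucvg _ (nbhs_infty_ge M)).
  have Nn : (N (mu n) <= n)%N.
    by apply: last_threshold_le; near: n; exact: nbhs_infty_ge.
  have hS : S n w <= (1 + dl (mu n)) * L n.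
    by rewrite leNgt; apply/negP => H; apply: (HM _ Mn); exists n.
  have [_ hg] := HN (mu n) n Nn.
  rewrite -expRD ler_expR; apply: critical_log_decay hS hg _.
  by rewrite ln_ge0// ler1n.
- suff H : (fun n => (normc (expR (g n * L n))%:C `^ (L n)^-1)%:E) @ \oo --> (expR (-1))%:E.
    by have [-> _] := cvg_limn_einf_sup H.
  apply/cvg_EFin; first by exists 0%N.
  have H : expR (g n) @[n --> \oo] --> expR (-1).
    apply: (@continuous_cvg _ _ _ _ _ _ expR); first exact: continuous_expR.
    rewrite -[X in _ --> X](_ : - (1 + 2 * 0) = -1); last by rewrite mulr0 addr0.
    apply: cvgN; apply: cvgD; first exact: cvg_cst.
    apply: cvgM; first exact: cvg_cst.
    exact: (cvg_comp _ _ mucvg cvg_harmonic).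
  apply: cvg_trans H; apply: near_eq_cvg; near=> n.
  rewrite /comp /= lil_root_expR//.
  by near: n; exact: lil_near_gt0.
Unshelve. all: end_near. Qed.

End hardy.

(** * Coefficient growth in terms of the limits superior and inferior *)

(** [lil] at variance [sigma ^ 2 / 4] is the inverse of the exponent, including
    where both are 0 by convention. *)
Lemma lnln_rootE (R : realType) (sigma : R) (a : nat -> R[i]) n : 0 < sigma ->
  lnln_root sigma a n = (normc (a n) `^ (lil (sigma ^+ 2 / 4) n%:R)^-1)%:E.
Proof.
move=> s0; rewrite /lnln_root /lil; congr (_ `^ _)%:E.
move: (n%:R * ln (ln n%:R)) => y.
have q0 : 0 < Num.sqrt 2 :> R by rewrite sqrtr_gt0.
have -> : 2 * (sigma ^+ 2 / 4) = (sigma / Num.sqrt 2) ^+ 2.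
  by rewrite expr_div_n sqr_sqrtr//; field.
rewrite sqrtrM ?sqr_ge0// sqrtr_sqr ger0_norm ?divr_ge0 ?ltW//.
by rewrite !invfM invrK mulrA [Num.sqrt 2 / sigma]mulrC.
Qed.

Lemma lt_between_pos (R : realType) (l : \bar R) (x : R) : 0 < x -> (l < x%:E)%E ->
  exists r, [/\ 0 < r, r < x & (l < r%:E)%E].
Proof.
move=> x0; case: l => [l|//|]; last first.
  by exists (x / 2); split; [lra|lra|rewrite ltNyr].
rewrite lte_fin => lx; have [l0|l0] := ltP 0 l.
  by exists ((l + x) / 2); rewrite lte_fin; split; lra.
by exists (x / 2); rewrite lte_fin; split; lra.
Qed.

Lemma gt_between (R : realType) (l : \bar R) (x y : R) : x < y -> (x%:E < l)%E ->
  exists r, [/\ x < r, r < y & (r%:E < l)%E].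
Proof.
move=> xy; case: l => [l||//]; last first.
  by exists ((x + y) / 2); split; [lra|lra|rewrite ltry].
rewrite lte_fin => xl; have [ly|yl] := ltP l y.
  by exists ((x + l) / 2); rewrite lte_fin; split; lra.
by exists ((x + y) / 2); rewrite lte_fin; split; lra.
Qed.

Section growth_rates.
Context {d : measure_display} {T : measurableType d} {R : realType}.
Variables (P : probability T R) (Y : nat -> {RV P >-> R}) (K v : R).
Hypothesis HY : centered_iid Y K v.
Variable X : nat -> {RV P >-> R}.
Hypothesis HX : {ae P, forall w, forall n, weight X n w = expR (walk Y 0 n w)}.
Let v_gt0 : 0 < v := iid_var_gt0 HY.
Local Notation root a := (fun n => (normc (a n) `^ (lil v n%:R)^-1)%:E).

Lemma Hstar_limsup_lt (a : nat -> R[i]) :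
  (limn_esup (root a) < (expR (-1))%:E)%E -> Hstar X a.
Proof.
move=> /(lt_between_pos (expR_gt0 _))[r [r0 r1 /limn_esup_lt ar]].
have s1 : 1 < - ln r by rewrite ltrNr -(expRK (-1)) ltr_ln ?posrE ?expR_gt0.
apply: (Hstar_lil_decay HY HX s1); near=> n.
rewrite opprK; apply: powR_inv_le; [|exact: normc_ge0|].
  by near: n; exact: lil_near_gt0.
by rewrite lnK ?posrE// -lee_fin; apply: ltW; near: n; exact: ar.
Unshelve. all: end_near. Qed.

Lemma Hstar_liminf_le (a : nat -> R[i]) : Hstar X a ->
  (limn_einf (root a) <= (expR (-1))%:E)%E.
Proof.
move=> Ha; rewrite leNgt; apply/negP => H.
have e1 : expR (-1) < 1 :> R by rewrite expR_lt1 oppr_lt0.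
have [r [r1 r2 /lt_limn_einf ar]] := gt_between e1 H.
have r0 : 0 < r by apply: lt_trans r1; exact: expR_gt0.
have s01 : 0 < - ln r < 1.
  rewrite oppr_gt0 ln_lt0 ?r0//= ltrNl -(expRK (-1)).
  by rewrite ltr_ln ?posrE ?expR_gt0.
apply: (notin_Hstar_lil_lower HY HX s01 _ Ha); near=> n.
rewrite opprK; apply: powR_inv_ge; [|exact: normc_ge0|].
  by near: n; exact: lil_near_gt0.
by rewrite lnK ?posrE// -lee_fin; apply: ltW; near: n; exact: ar.
Unshelve. all: end_near. Qed.

Lemma Hstar_limsup_le1 (a : nat -> R[i]) : Hstar X a -> (limn_esup (root a) <= 1)%E.
Proof.
move=> Ha; rewrite leNgt; apply/negP => H.
have [r [r1 _ /lt_limn_esup ar]] := gt_between (ltr1n R 2) H.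
have r0 : 0 < r by lra.
apply: (notin_Hstar_lil_upper HY HX (ln_gt0 r1) _ Ha) => m.
have [N _ HN] := lil_near_gt0 v_gt0.
have [n Nn an] := ar (m + N)%N; exists n; first exact: leq_trans (leq_addr _ _) Nn.
apply: powR_inv_ge; [|exact: normc_ge0|].
  exact: HN (leq_trans (leq_addl _ _) Nn).
by rewrite lnK ?posrE// -lee_fin; apply: ltW.
Qed.

Lemma subcritical_Hstar (c : R) : 0 <= c < expR (-1) -> exists a : nat -> R[i],
  [/\ forall n, normc (a n) <= 1, Hstar X a & limn_einf (root a) = c%:E].
Proof.
move=> /andP[]; rewrite le_eqVlt => /orP[/eqP <- _|c0 c1].
  exists (fun=> 0); split.
  - by move=> n; rewrite normc0.
  - apply: (Hstar_lil_decay HY HX (ltr1n R 2)); near=> n.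
    by rewrite normc0 expR_ge0.
  - suff H : root (fun=> 0 : R[i]) @ \oo --> (0 : R)%:E by have [-> _] := cvg_limn_einf_sup H.
    apply: cvg_near_cst; near=> n; rewrite normc0 powR0// invr_neq0// gt_eqF//.
    by near: n; exact: lil_near_gt0.
have s1 : 1 < - ln c by rewrite ltrNr -(expRK (-1)) ltr_ln ?posrE ?expR_gt0.
exists (fun n => (expR (ln c * lil v n%:R))%:C); split.
- move=> n; rewrite normc_real ?expR_ge0// -[leRHS](expR0 R) ler_expR.
  by rewrite mulr_le0_ge0 ?lil_ge0//; lra.
- apply: (Hstar_lil_decay HY HX s1); near=> n.
  by rewrite normc_real ?expR_ge0// opprK.
- set a := (X in root X); suff H : root a @ \oo --> c%:E by have [-> _] := cvg_limn_einf_sup H.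
  apply: cvg_near_cst; near=> n; rewrite /a lil_root_expR ?lnK ?posrE//.
  by near: n; exact: lil_near_gt0.
Unshelve. all: end_near. Qed.

End growth_rates.

Local Open Scope ereal_scope.

Theorem theorem5p7 (d : measure_display) (T : measurableType d) (R : realType)
    (P : probability T R) (X : nat -> {RV P >-> R}) (sigma : R)
    (X_nonneg : forall n, {ae P, forall w, (0 <= X n w)%R})
    (X_bounded : exists M : R, forall n, {ae P, forall w, (X n w <= M)%R})
    (X_indep : mutually_independent X)
    (X_ident : identically_distributed X)
    (* lne is the extended logarithm, with lne 0 = -oo *)
    (X_mean : \int[P]_w lne (X 0%N w)%:E = 0)
    (sigma_gt0 : (0 < sigma)%R)
    (X_moment2 : \int[P]_w (lne ((X 0%N w) ^+ 2)%:E) ^+ 2 = (sigma ^+ 2)%:E) :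
  (* (i) *)
  (forall a : nat -> R[i], analytic_series a ->
     limn_esup (lnln_root sigma a) < (expR (-1))%:E -> Hstar X a) /\
  (* (ii) *)
  (forall a : nat -> R[i], analytic_series a ->
     (expR (-1))%:E < limn_einf (lnln_root sigma a) \/
     1 < limn_esup (lnln_root sigma a) -> ~ Hstar X a) /\
  (* (iii) *)
  ((expR (-1))%:E <=
     ereal_sup [set limn_esup (lnln_root sigma a) | a in Hstar X] <= 1 /\
   (forall c : R, (expR (-1) <= c <= 1)%R ->
      exists a : nat -> R[i], [/\ analytic_series a, Hstar X a &
        limn_esup (lnln_root sigma a) = c%:E])) /\
  (* (iv) *)
  ((forall a : nat -> R[i], Hstar X a ->
      0 <= limn_einf (lnln_root sigma a) <= (expR (-1))%:E) /\
   (forall c : R, (0 <= c <= expR (-1))%R ->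
      exists a : nat -> R[i], [/\ analytic_series a, Hstar X a &
        limn_einf (lnln_root sigma a) = c%:E])).
Proof.
have [M XM] := X_bounded.
have HY := log_step_iid X_nonneg XM X_indep X_ident X_mean sigma_gt0 X_moment2.
have HX := ae_weight X_nonneg XM X_ident X_moment2.
have rootE (a : nat -> R[i]) : lnln_root sigma a =
    (fun n => (normc (a n) `^ (lil (sigma ^+ 2 / 4) n%:R)^-1)%R%:E).
  by apply/funext => n; exact: lnln_rootE.
have e1 : (expR (-1) < 1 :> R)%R by rewrite expR_lt1 oppr_lt0.
have sup_achieved (c : R) : (expR (-1) <= c <= 1)%R ->
    exists a : nat -> R[i], [/\ analytic_series a, Hstar X a &
      limn_esup (lnln_root sigma a) = c%:E].
  move=> /andP[c0 c1]; have c01 : (0 < c <= 1)%R.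
    by rewrite c1 andbT (lt_le_trans _ c0)// expR_gt0.
  have [a [a1 Ha La]] := sparse_Hstar HY HX c01.
  by exists a; split; [exact: analytic_series_le1|by []|rewrite rootE].
split; first by move=> a _; rewrite rootE; exact: (Hstar_limsup_lt HY HX).
split.
  move=> a _; rewrite rootE => -[|] + Ha; apply/negP; rewrite -leNgt.
    exact: (Hstar_liminf_le HY HX Ha).
  exact: (Hstar_limsup_le1 HY HX Ha).
split.
  split=> //; apply/andP; split.
    have [|a [_ Ha <-]] := sup_achieved (expR (-1)); first by rewrite lexx ltW.
    by apply: ereal_sup_ubound; exists a.
  by apply: ge_ereal_sup => _ [a Ha <-]; rewrite rootE; exact: (Hstar_limsup_le1 HY HX Ha).
split=> [a Ha|c /andP[c0]].
  rewrite rootE (Hstar_liminf_le HY HX Ha) andbT.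
  by apply: limn_einf_ge => n; rewrite lee_fin powR_ge0.
rewrite le_eqVlt => /orP[/eqP ->|c1].
  have [a [a1 Ha La]] := critical_Hstar HY HX.
  by exists a; split; [exact: analytic_series_le1|by []|rewrite rootE].
have [|a [a1 Ha La]] := subcritical_Hstar HY HX (c := c); first by rewrite c0.
by exists a; split; [exact: analytic_series_le1|by []|rewrite rootE].
Qed.
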